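(* Let $\gamma>0$ be such that $\sigma\left(A\otimes I+I\otimes A+\frac{1}{\gamma^2}\sum_{k=1}^m N_k\otimes N_k\right)\subset\mathbb C_-$. Let $y_{x_0}$ be the output of $$\dot x_{x_0}(t)=Ax_{x_0}(t)+\sum_{k=1}^mN_kx_{x_0}(t)u_k(t),\quad x_{x_0}(0)=X_0v_0,\qquad y_{x_0}(t)=Cx_{x_0}(t),$$ and let $\tilde y_{x_0}$ be the output of the reduced system $$\dot{\tilde x}_{x_0}(t)=\tilde A_{x_0}\tilde x_{x_0}(t)+\sum_{k=1}^m\tilde N_{x_0,k}\tilde x_{x_0}(t)u_k(t),\quad\tilde x_{x_0}(0)=\tilde X_0v_0,\qquad\tilde y_{x_0}(t)=\tilde C_{x_0}\tilde x_{x_0}(t),$$ whose matrices are given either by BT or by SPA (see context), based on a balancing transformation $\mathcal S$ with $\Theta_1>0$. In the case of SPA assume that the reduced Gramian $\tilde P$ exists. Let $Y=\begin{bmatrix}Y_1 \\ Y_2\end{bmatrix}$ be the unique solution of $$\begin{bmatrix}\mathcal A_{11} & \mathcal A_{12} \\ \mathcal A_{21} & \mathcal A_{22}\end{bmatrix}\begin{bmatrix}Y_1 \\ Y_2\end{bmatrix}+\begin{bmatrix}Y_1 \\ Y_2\end{bmatrix}\tilde A_{x_0}^\top+\frac1{\gamma^2}\sum_{k=1}^m\begin{bmatrix}\mathcal N_{k,11} & \mathcal N_{k,12} \\ \mathcal N_{k,21} & \mathcal N_{k,22}\end{bmatrix}\begin{bmatrix}Y_1 \\ Y_2\end{bmatrix}\tilde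 N_{x_0,k}^\top=-\begin{bmatrix}X_{0,1} \\ X_{0,2}\end{bmatrix}X_{0,1}^\top.$$ Then $$\|y_{x_0}-\tilde y_{x_0}\|_{L^2}\le\left(\operatorname{tr}(\Theta_2\mathcal W_{x_0})\right)^{\frac12}\exp\left\{0.5\,\|\gamma u^0\|_{L^2}^2\right\}\|v_0\|_2,$$ where $$\mathcal W_{x_0}=X_{0,2}X_{0,2}^\top+2Y_2\mathbf A_{21}^\top+2[\mathcal A_{21}\ \mathcal A_{22}]Y\bar{\mathbf A}_{21}^\top+\frac1{\gamma^2}\sum_{k=1}^m\left(2[\mathcal N_{k,21}\ \mathcal N_{k,22}]Y\mathbf N_{k,21}^\top-\mathbf N_{k,21}\tilde P\mathbf N_{k,21}^\top\right)$$ with $(\mathbf A_{21},\bar{\mathbf A}_{21},\mathbf N_{k,21})=(\mathcal A_{21},0,\mathcal N_{k,21})$ for BT and $(\mathbf A_{21},\bar{\mathbf A}_{21},\mathbf N_{k,21})=(0,-\mathcal A_{22}^{-1}\mathcal A_{21},\mathcal N_{k,21}-\mathcal N_{k,22}\mathcal A_{22}^{-1}\mathcal A_{21})$ for SPA.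
   Context: Setting. $A,N_1,\ldots,N_m\in\mathbb R^{n\times n}$, $C\in\mathbb R^{p\times n}$, $X_0\in\mathbb R^{n\times q}$, $v_0\in\mathbb R^q$; $A$ is Hurwitz, i.e. $\sigma(A)\subset\mathbb C_-=\{z\in\mathbb C:\Re(z)<0\}$ ($\sigma(\cdot)$ is the spectrum). The control $u=(u_1,\ldots,u_m)^\top:[0,\infty)\to\mathbb R^m$ lies in $L^2$, with $\|f\|_{L^2}^2=\int_0^\infty\|f(s)\|_2^2\,ds$. The function $u^0=(u_1^0,\ldots,u_m^0)^\top$ is given by $u_k^0\equiv0$ if $N_k=0$ and $u_k^0=u_k$ otherwise. $M>0$ means symmetric positive definite. Gramians. $P_0$ and $Q$ are the solutions of $AP_0+P_0A^\top+\frac1{\gamma^2}\sum_kN_kP_0N_k^\top=-X_0X_0^\top$ and $A^\top Q+QA+\frac1{\gamma^2}\sum_kN_k^\top QN_k=-C^\top C$ (unique under the spectral condition in the claim). Balancing. $\mathcal S\in\mathbb R^{n\times n}$ is an invertible matrix with $\mathcal SP_0\mathcal S^\top=\mathcal S^{-\top}Q\mathcal S^{-1}=\Theta=\operatorname{diag}(\theta_1,\ldots,\theta_n)=\begin{bmatrix}\Theta_1 & 0 \\ 0 & \Theta_2\end{bmatrix}$, $\Theta_1\in\mathbb R^{r_{x_0}\times r_{x_0}}$, where $\theta_i$ are the square roots of the eigenvalues of $P_0Q$ (Hankel singular values) and $\Theta_2=\operatorname{diag}(\theta_{r_{x_0}+1},\ldots,\theta_n)$ contains the $n-r_{x_0}$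 smallest ones. Partition, with first block of size $r_{x_0}$, $\mathcal SA\mathcal S^{-1}=\begin{bmatrix}\mathcal A_{11} & \mathcal A_{12} \\ \mathcal A_{21} & \mathcal A_{22}\end{bmatrix}$, $\mathcal SX_0=\begin{bmatrix}X_{0,1} \\ X_{0,2}\end{bmatrix}$, $C\mathcal S^{-1}=[\mathcal C_1\ \mathcal C_2]$, $\mathcal SN_k\mathcal S^{-1}=\begin{bmatrix}\mathcal N_{k,11} & \mathcal N_{k,12} \\ \mathcal N_{k,21} & \mathcal N_{k,22}\end{bmatrix}$. Likewise $Y\in\mathbb R^{n\times r_{x_0}}$ with $Y_1\in\mathbb R^{r_{x_0}\times r_{x_0}}$. Reduced matrices. - BT (balanced truncation): $(\tilde A_{x_0},\tilde X_0,\tilde C_{x_0},\tilde N_{x_0,k})=(\mathcal A_{11},X_{0,1},\mathcal C_1,\mathcal N_{k,11})$; - SPA (singular perturbation approximation; $\mathcal A_{22}$ invertible): $(\tilde A_{x_0},\tilde X_0,\tilde C_{x_0},\tilde N_{x_0,k})=(\mathcal A_{11}-\mathcal A_{12}\mathcal A_{22}^{-1}\mathcal A_{21},\,X_{0,1},\,\mathcal C_1-\mathcal C_2\mathcal A_{22}^{-1}\mathcal A_{21},\,\mathcal N_{k,11}-\mathcal N_{k,12}\mathcal A_{22}^{-1}\mathcal A_{21})$. Reduced Gramian: $\tilde P=\int_0^\infty\tilde Z_\gamma(s)\,ds$ (it ''exists'' if the integral converges), where $\dot{\tilde Z}_\gamma=\tilde A_{x_0}\tilde Z_\gamma+\tilde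 Z_\gamma\tilde A_{x_0}^\top+\frac1{\gamma^2}\sum_k\tilde N_{x_0,k}\tilde Z_\gamma\tilde N_{x_0,k}^\top$, $\tilde Z_\gamma(0)=\tilde X_0\tilde X_0^\top$. *)

(* Defs.v *)
From HB Require Import structures.
From mathcomp Require Import all_boot all_order all_algebra.
From mathcomp Require Import all_classical all_reals all_analysis.
From mathcomp Require Import complex mxtens.

Set Implicit Arguments.
Unset Strict Implicit.
Unset Printing Implicit Defensive.

Import Order.TTheory GRing.Theory Num.Theory.
Import numFieldNormedType.Exports.

Local Open Scope classical_set_scope.
Local Open Scope ring_scope.

Definition stable_spectrum (R : realType) n (M : 'M[R]_n) : Prop :=
  forall z : R[i],
    eigenvalue (map_mx (real_complex R) M) z -> complex.Re z < 0.

(* A (x) I + I (x) A + gamma^-2 sum_k N_k (x) N_k *)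
Definition kron_lyapunov (R : realType) n m (gamma : R)
    (A : 'M[R]_n) (N : 'I_m -> 'M[R]_n) : 'M[R]_(n * n) :=
  A *t 1%:M + 1%:M *t A + gamma ^- 2 *: \sum_(k < m) (N k *t N k).

(* The rectangular case covers the mixed equation that defines Y. *)
Definition gen_sylvester (R : realType) n r m (gamma : R)
    (A : 'M[R]_n) (N : 'I_m -> 'M[R]_n)
    (B : 'M[R]_r) (K : 'I_m -> 'M[R]_r) (Z : 'M[R]_(n, r)) : 'M[R]_(n, r) :=
  A *m Z + Z *m B^T + gamma ^- 2 *: \sum_(k < m) (N k *m Z *m (K k)^T).

Definition gen_lyapunov (R : realType) n m (gamma : R)
    (A : 'M[R]_n) (N : 'I_m -> 'M[R]_n) (Z : 'M[R]_n) : 'M[R]_n :=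
  gen_sylvester gamma A N A N Z.

Definition posdefmx (R : realType) n (M : 'M[R]_n) : Prop :=
  M^T = M /\ forall x : 'cV[R]_n, x != 0 -> 0 < (x^T *m M *m x) 0 0.

Definition norm2 (R : realType) n (v : 'cV[R]_n) : R :=
  Num.sqrt (\sum_(i < n) v i 0 ^+ 2).

(* Functions of time are total on R; only their values on [0, +oo[ matter. *)
Definition L2norm (R : realType) n (f : R -> 'cV[R]_n) : \bar R :=
  'N[@lebesgue_measure R]_(2%:E)
    [(fun s => (norm2 (f s))%:E) \_ `[0, +oo[].

Definition in_L2 (R : realType) n (f : R -> 'cV[R]_n) : Prop :=
  (forall i, measurable_fun (`[0, +oo[%classic : set R) (fun s : R => f s i 0)) /\
  (L2norm f < +oo)%E.

Definition ctrl0 (R : realType) n m (N : 'I_m -> 'M[R]_n)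
    (u : R -> 'cV[R]_m) (t : R) : 'cV[R]_m :=
  \col_k (if N k == 0 then 0 else u t k 0).

(* Caratheodory solution: u is merely L^2, so the differential equation is
   understood in its integrated form. Continuity of x and u in L^2 make the
   integrand integrable on every [0, t]. *)
Definition bilinear_solution (R : realType) n m (A : 'M[R]_n)
    (N : 'I_m -> 'M[R]_n) (u : R -> 'cV[R]_m) (x0 : 'cV[R]_n)
    (x : R -> 'cV[R]_n) : Prop :=
  {within `[0, +oo[, continuous x} /\
  forall t : R, 0 <= t -> forall i,
    x t i 0 = x0 i 0 +
      \int[@lebesgue_measure R]_(s in `[0, t])
        ((A *m x s + \sum_(k < m) u s k 0 *: (N k *m x s)) i 0).

Definition matrix_ode_solution (R : realType) n (L : 'M[R]_n -> 'M[R]_n)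
    (Z0 : 'M[R]_n) (Z : R -> 'M[R]_n) : Prop :=
  [/\ Z 0 = Z0,
      {within `[0, +oo[, continuous Z} &
      forall t : R, 0 < t -> forall i j,
        is_derive t (1 : R) (fun s => Z s i j) (L (Z t) i j)].

Definition mx_integral_to (R : realType) n (Z : R -> 'M[R]_n) (T : R)
    : 'M[R]_n :=
  \matrix_(i, j) \int[@lebesgue_measure R]_(s in `[0, T]) Z s i j.

Definition mx_improper_converges (R : realType) n (Z : R -> 'M[R]_n) : Prop :=
  forall i j, cvg (mx_integral_to Z T i j @[T --> +oo]).

(* Equals int_0^oo Z(s) ds when the improper integral converges. *)
Definition mx_improper_integral (R : realType) n (Z : R -> 'M[R]_n)
    : 'M[R]_n :=
  \matrix_(i, j) lim (mx_integral_to Z T i j @[T --> +oo]).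

(* theta lists the Hankel singular values: the square roots of the eigenvalues
   of P *m Q, with multiplicity; the last d of them are the smallest. *)
Definition balancing (R : realType) r d (P Q S : 'M[R]_(r + d))
    (theta : 'rV[R]_(r + d)) : Prop :=
  [/\ S \in unitmx,
      S *m P *m S^T = diag_mx theta,
      (invmx S)^T *m Q *m invmx S = diag_mx theta,
      (forall i, 0 <= theta 0 i) /\
      char_poly (P *m Q) = \prod_i ('X - (theta 0 i ^+ 2)%:P) &
      forall (i : 'I_r) (j : 'I_d),
        theta 0 (rshift r j) <= theta 0 (lshift d i)].

Inductive reduction := BT | SPA.

(* In all the definitions below, A, N, X0, C are the balanced matrices
   S A S^-1, S N_k S^-1, S X_0, C S^-1, with first block of size r. *)
Section Reduced.
Variables (R : realType) (r d : nat).
Implicit Types A N : 'M[R]_(r + d).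

Definition red_A (meth : reduction) A : 'M[R]_r :=
  match meth with
  | BT => ulsubmx A
  | SPA => ulsubmx A - ursubmx A *m invmx (drsubmx A) *m dlsubmx A
  end.

Definition red_N (meth : reduction) A N : 'M[R]_r :=
  match meth with
  | BT => ulsubmx N
  | SPA => ulsubmx N - ursubmx N *m invmx (drsubmx A) *m dlsubmx A
  end.

Definition red_C (meth : reduction) p A (C : 'M[R]_(p, r + d))
    : 'M[R]_(p, r) :=
  match meth with
  | BT => lsubmx C
  | SPA => lsubmx C - rsubmx C *m invmx (drsubmx A) *m dlsubmx A
  end.

Definition red_X0 q (X0 : 'M[R]_(r + d, q)) : 'M[R]_(r, q) := usubmx X0.

Definition bold_A21 (meth : reduction) A : 'M[R]_(d, r) :=
  match meth with BT => dlsubmx A | SPA => 0 end.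

Definition bold_A21_bar (meth : reduction) A : 'M[R]_(d, r) :=
  match meth with BT => 0 | SPA => - (invmx (drsubmx A) *m dlsubmx A) end.

Definition bold_N21 (meth : reduction) A N : 'M[R]_(d, r) :=
  match meth with
  | BT => dlsubmx N
  | SPA => dlsubmx N - drsubmx N *m invmx (drsubmx A) *m dlsubmx A
  end.

Definition W_x0 (meth : reduction) m q (gamma : R) A
    (N : 'I_m -> 'M[R]_(r + d)) (X0 : 'M[R]_(r + d, q))
    (Y : 'M[R]_(r + d, r)) (Pt : 'M[R]_r) : 'M[R]_d :=
  dsubmx X0 *m (dsubmx X0)^T
  + 2 *: (dsubmx Y *m (bold_A21 meth A)^T)
  + 2 *: (dsubmx A *m Y *m (bold_A21_bar meth A)^T)
  + gamma ^- 2 *: \sum_(k < m)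
      (2 *: (dsubmx (N k) *m Y *m (bold_N21 meth A (N k))^T)
       - bold_N21 meth A (N k) *m Pt *m (bold_N21 meth A (N k))^T).

End Reduced.

(* Main.v *)
(** The error is the output of the block-diagonal system coupling the balanced
    full model and the reduced one. Its Gramian [Pe = [[Theta, Y], [Y^T, Pt]]]
    solves a generalized Lyapunov equation [L Pe = - Xe Xe^T], and the identity
    [tr (Ce Pe Ce^T) = tr (Theta2 W)] is the duality between [L] and its adjoint,
    applied to the observability equation.

    Young's inequality shows that [M = g z z^T], with
    [g = exp (- gamma^2 int |u0|^2 - 2 e t)], satisfies [M' <= (L - 2 e) M], so
    that [(L - 2 e) (Pe - int M) <= 0]. A generalized Lyapunov operator whose
    adjoint maps some positive definite [V] to a negative definite matrix is
    inverse positive; hence [int M <= Pe], and letting [e] tend to 0 gives the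
    bound.

    The matrix [Theta1] shows that the reduced operator is semistable, for both
    reduction methods, and the Kronecker spectrum provides [V] for the full
    operator. Shifting the two diagonal blocks in opposite directions does not
    change the equation of [Y] and makes both of them strictly stable, which gives
    [Pe >= 0] without discussing the uniqueness of [Y]. *)

Require Import Defs.
From HB Require Import structures.
From mathcomp Require Import all_boot all_order all_algebra.
From mathcomp Require Import all_classical all_reals all_analysis.
From mathcomp Require Import complex mxtens.
From mathcomp Require Import measurable_realfun ring lra.

Set Implicit Arguments.
Unset Strict Implicit.
Unset Printing Implicit Defensive.

Import Order.TTheory GRing.Theory Num.Theory.
Import numFieldNormedType.Exports.

Local Open Scope classical_set_scope.
Local Open Scope ring_scope.

(** * Quadratic forms *)

Section QuadraticForm.
Variable R : realType.

(** The coupled operator is only semistable, because nothing better than [Theta1] is available for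
    its reduced block. Inverse positivity therefore never applies to it directly: each comparison is
    made for a shifted operator and up to a finite horizon [T], where the damping [expR (- 2 e T)]
    tends to 1 with [e]; the horizon goes to infinity only afterwards.

    Stability enters only through certificates, which are inequalities between quadratic forms, so
    every comparison ends as linear arithmetic on scalars. To obtain a certificate it is enough to
    exclude real eigenvalues [s >= 0] with symmetric eigenmatrices. This is a Perron-Frobenius
    effect: the flow of a generalized Lyapunov operator preserves the positive semidefinite cone, so
    its spectral abscissa is a real eigenvalue.

    The control is merely square integrable, so trajectories are absolutely continuous and have no
    derivative at a given time. The calculus below works with pairs of a function and an integrable
    density. *)

Definition qf n (M : 'M[R]_n) (x : 'cV[R]_n) : R := (x^T *m M *m x) 0 0.

Lemma qfE n (M : 'M[R]_n) x : qf M x = \sum_i \sum_j x i 0 * M i j * x j 0.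
Proof.
rewrite /qf mxE; under eq_bigr => j _ do rewrite mxE big_distrl /=.
rewrite exchange_big; apply: eq_bigr => i _; apply: eq_bigr => j _.
by rewrite mxE.
Qed.

Lemma qfD n (M1 M2 : 'M[R]_n) x : qf (M1 + M2) x = qf M1 x + qf M2 x.
Proof. by rewrite /qf mulmxDr mulmxDl mxE. Qed.

Lemma qfZ n a (M : 'M[R]_n) x : qf (a *: M) x = a * qf M x.
Proof. by rewrite /qf -scalemxAr -scalemxAl mxE. Qed.

Lemma qfN n (M : 'M[R]_n) x : qf (- M) x = - qf M x.
Proof. by rewrite -scaleN1r qfZ mulN1r. Qed.

Lemma qfB n (M1 M2 : 'M[R]_n) x : qf (M1 - M2) x = qf M1 x - qf M2 x.
Proof. by rewrite qfD qfN. Qed.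

Lemma qf0 n x : qf (0 : 'M[R]_n) x = 0.
Proof. by rewrite /qf mulmx0 mul0mx mxE. Qed.

Lemma qf_sum n m (F : 'I_m -> 'M[R]_n) x :
  qf (\sum_k F k) x = \sum_k qf (F k) x.
Proof. by rewrite /qf mulmx_sumr mulmx_suml summxE. Qed.

Lemma qf_tr n (M : 'M[R]_n) x : qf M^T x = qf M x.
Proof.
rewrite /qf.
have -> : x^T *m M^T *m x = (x^T *m M *m x)^T by rewrite !trmx_mul trmxK mulmxA.
by rewrite mxE.
Qed.

Lemma qf_congr n k (B : 'M[R]_(n, k)) (M : 'M[R]_k) x :
  qf (B *m M *m B^T) x = qf M (B^T *m x).
Proof. by rewrite /qf trmx_mul trmxK !mulmxA. Qed.

Lemma qf_scalarmx n (c : R) (x : 'cV[R]_n) : qf c%:M x = c * qf 1%:M x.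
Proof. by rewrite -(scalemx1 _ c) qfZ. Qed.

Lemma qf1E n (x : 'cV[R]_n) : qf 1%:M x = \sum_i x i 0 ^+ 2.
Proof. by rewrite /qf mulmx1 mxE; apply: eq_bigr => i _; rewrite mxE. Qed.

Lemma qf1_ge0 n (x : 'cV[R]_n) : 0 <= qf 1%:M x.
Proof. by rewrite qf1E; apply: sumr_ge0 => i _; exact: sqr_ge0. Qed.

(** Stated without a symmetry clause: only the symmetric part is seen, and a proof is just a family
    of scalar inequalities. *)
Definition psd n (M : 'M[R]_n) := forall x, 0 <= qf M x.

Definition nrm m n (M : 'M[R]_(m, n)) : R := \sum_i \sum_j `|M i j|.

Lemma nrm_ge0 m n (M : 'M[R]_(m, n)) : 0 <= nrm M.
Proof. by apply: sumr_ge0 => i _; apply: sumr_ge0. Qed.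

Lemma nrmD m n (M1 M2 : 'M[R]_(m, n)) : nrm (M1 + M2) <= nrm M1 + nrm M2.
Proof.
rewrite /nrm -big_split; apply: ler_sum => i _; rewrite -big_split.
by apply: ler_sum => j _; rewrite mxE ler_normD.
Qed.

Lemma nrmZ m n a (M : 'M[R]_(m, n)) : nrm (a *: M) = `|a| * nrm M.
Proof.
rewrite /nrm mulr_sumr; apply: eq_bigr => i _; rewrite mulr_sumr.
by apply: eq_bigr => j _; rewrite mxE normrM.
Qed.

Lemma ler_qf_nrm n (M : 'M[R]_n) x : `|qf M x| <= nrm M * qf 1%:M x.
Proof.
have xx i j : `|x i 0| * `|x j 0| <= qf 1%:M x.
  have xi k : `|x k 0| ^+ 2 <= qf 1%:M x.
    rewrite qf1E (bigD1 k) //= real_normK ?num_real // lerDl.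
    by apply: sumr_ge0 => ? _; exact: sqr_ge0.
  have := xi i; have := xi j; have := sqr_ge0 (`|x i 0| - `|x j 0|).
  by move: `|x i 0| `|x j 0| => a b; nra.
rewrite qfE (le_trans (ler_norm_sum _ _ _))// /nrm mulr_suml.
apply: ler_sum => i _; rewrite (le_trans (ler_norm_sum _ _ _))// mulr_suml.
apply: ler_sum => j _; rewrite !normrM mulrAC mulrC.
by rewrite ler_wpM2l.
Qed.

Lemma qf_polar n (M : 'M[R]_n) x y : M^T = M ->
  qf M (x + y) = qf M x + qf M y + 2 * (x^T *m M *m y) 0 0.
Proof.
move=> sM; rewrite /qf.
have -> : (x + y)^T = x^T + y^T by rewrite raddfD.
have mD (X Z : 'M[R]_1) : (X + Z) 0 0 = X 0 0 + Z 0 0 by rewrite mxE.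
rewrite !mulmxDl !mulmxDr !mD.
have -> : (y^T *m M *m x) 0 0 = (x^T *m M *m y) 0 0.
  have -> : y^T *m M *m x = (x^T *m M *m y)^T.
    by rewrite !trmx_mul trmxK sM mulmxA.
  by rewrite mxE.
by ring.
Qed.

Lemma sym_qf0 n (M : 'M[R]_n) : M^T = M -> (forall x, qf M x = 0) -> M = 0.
Proof.
move=> sM h; apply/matrixP => i j.
have := qf_polar (delta_mx i 0) (delta_mx j 0) sM.
rewrite !h add0r add0r => /esym/eqP; rewrite mulf_eq0 pnatr_eq0 /= => /eqP.
by rewrite trmx_delta -rowE -colE !mxE.
Qed.

End QuadraticForm.

(** * Generalized Lyapunov operators *)

Section GenLyapunov.
Variables (R : realType) (n m : nat) (gamma : R).
Implicit Types (A V W Z : 'M[R]_n) (N : 'I_m -> 'M[R]_n).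

Lemma gen_lyapunovE A N Z : gen_lyapunov gamma A N Z =
  A *m Z + Z *m A^T + gamma ^- 2 *: \sum_k N k *m Z *m (N k)^T.
Proof. by []. Qed.

Lemma gen_lyapunov_linear A N : linear (gen_lyapunov gamma A N).
Proof.
move=> a Z1 Z2; rewrite !gen_lyapunovE.
under eq_bigr => k _ do rewrite mulmxDr mulmxDl -scalemxAr -scalemxAl.
rewrite big_split -scaler_sumr /= mulmxDr mulmxDl -scalemxAr -scalemxAl.
rewrite !scalerDr !scalerA [gamma ^- 2 * a]mulrC.
by rewrite [X in X + _ = _]addrACA [LHS]addrACA.
Qed.

Lemma gen_lyapunovD A N Z1 Z2 : gen_lyapunov gamma A N (Z1 + Z2) =
  gen_lyapunov gamma A N Z1 + gen_lyapunov gamma A N Z2.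
Proof. by have := gen_lyapunov_linear A N 1 Z1 Z2; rewrite !scale1r. Qed.

Lemma gen_lyapunov0 A N : gen_lyapunov gamma A N 0 = 0.
Proof.
rewrite gen_lyapunovE mulmx0 mul0mx big1 ?scaler0 ?addr0// => k _.
by rewrite mulmx0 mul0mx.
Qed.

Lemma gen_lyapunovZ A N a Z :
  gen_lyapunov gamma A N (a *: Z) = a *: gen_lyapunov gamma A N Z.
Proof.
by have := gen_lyapunov_linear A N a Z 0; rewrite gen_lyapunov0 !addr0.
Qed.

Lemma gen_lyapunovN A N Z :
  gen_lyapunov gamma A N (- Z) = - gen_lyapunov gamma A N Z.
Proof. by rewrite -scaleN1r gen_lyapunovZ scaleN1r. Qed.

Lemma gen_lyapunovB A N Z1 Z2 : gen_lyapunov gamma A N (Z1 - Z2) =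
  gen_lyapunov gamma A N Z1 - gen_lyapunov gamma A N Z2.
Proof. by rewrite gen_lyapunovD gen_lyapunovN. Qed.

Lemma gen_lyapunov_tr A N Z :
  (gen_lyapunov gamma A N Z)^T = gen_lyapunov gamma A N Z^T.
Proof.
rewrite !gen_lyapunovE !raddfD /= linearZ /= raddf_sum /= !trmx_mul trmxK.
rewrite [_ *m A^T + _]addrC; congr (_ + _ *: _).
by apply: eq_bigr => k _; rewrite !trmx_mul trmxK mulmxA.
Qed.

Lemma gen_lyapunov_shift A N e Z : gen_lyapunov gamma (A - e%:M) N Z =
  gen_lyapunov gamma A N Z - (2 * e) *: Z.
Proof.
rewrite !gen_lyapunovE mulmxDl raddfD raddfN /= mulmxDr mulmxN mulNmx.
rewrite tr_scalar_mx mul_scalar_mx mul_mx_scalar -[RHS]addrAC addrACA.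
by rewrite -opprD -scalerDl mulr_natl.
Qed.

Lemma qf_gen_lyapunovDZ A N Z1 a Z2 x :
  qf (gen_lyapunov gamma A N (Z1 + a *: Z2)) x =
  qf (gen_lyapunov gamma A N Z1) x + a * qf (gen_lyapunov gamma A N Z2) x.
Proof. by rewrite addrC gen_lyapunov_linear qfD qfZ addrC. Qed.

(* The left-hand side is positive in [D]: up to the [h ^+ 2] term, one Euler
   step for [Z' = L Z] preserves the positive semidefinite cone. *)
Lemma gen_lyapunov_euler A N (h : R) D :
  (1%:M + h *: A) *m D *m (1%:M + h *: A)^T
    + (h * gamma ^- 2) *: \sum_k N k *m D *m (N k)^T =
  D + h *: gen_lyapunov gamma A N D + h ^+ 2 *: (A *m D *m A^T).
Proof.
rewrite gen_lyapunovE scalerDr [RHS]addrAC scalerA addrA; congr (_ + _).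
rewrite raddfD /= linearZ /= trmx1 mulmxDl mul1mx mulmxDr mulmx1 mulmxDl.
rewrite -!scalemxAl -!scalemxAr scalerA -expr2 scalerDr !addrA.
by rewrite -[RHS]addrA [RHS]addrAC [in RHS]addrA.
Qed.

Lemma euler_ge A N (h : R) D x : 0 <= h -> psd D ->
  0 <= qf D x + h * qf (gen_lyapunov gamma A N D) x
       + h ^+ 2 * (nrm (A *m D *m A^T) * qf 1%:M x).
Proof.
move=> h0 Dp.
have : 0 <= qf ((1%:M + h *: A) *m D *m (1%:M + h *: A)^T
    + (h * gamma ^- 2) *: \sum_k N k *m D *m (N k)^T) x.
  rewrite qfD qfZ qf_sum addr_ge0 ?qf_congr ?Dp// mulr_ge0//.
    by rewrite mulr_ge0 ?invr_ge0 ?sqr_ge0.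
  by apply: sumr_ge0 => k _; rewrite qf_congr Dp.
rewrite gen_lyapunov_euler; move: (gen_lyapunov gamma A N D) => L.
rewrite !qfD !qfZ.
move=> h1; apply: (le_trans h1); rewrite lerD2l ler_wpM2l ?sqr_ge0//.
by rewrite (le_trans (ler_norm _)) ?ler_qf_nrm.
Qed.

(** Positivity of one Euler step gives [D >= h c - h^2 K] for every [h >= 0], so a strictly negative
    image forces [D] into the interior of the cone. *)
Lemma psd_gen_lyapunov_lower A N D c : 0 < c -> psd D ->
  (forall x, qf (gen_lyapunov gamma A N D) x <= - c * qf 1%:M x) ->
  exists2 e, 0 < e & forall x, e * qf 1%:M x <= qf D x.
Proof.
move=> c0 Dp Lc; set K := nrm (A *m D *m A^T).
have K0 : 0 <= K by exact: nrm_ge0.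
(* With this [h] the quadratic error uses up at most half of [h c]; the [+ 1] in the witness covers
   [K = 0]. *)
have [h h0 hK] : exists2 h, 0 < h & h * K <= c / 2.
  exists (c / (2 * (K + 1))); first by rewrite divr_gt0// mulr_gt0//; lra.
  rewrite mulrAC ler_pdivrMr ?mulr_gt0//; last by lra.
  by nra.
exists (h * c / 2); first by have := mulr_gt0 h0 c0; lra.
move=> x; have := euler_ge A N x (ltW h0) Dp.
rewrite -/K; have := ler_wpM2l (ltW h0) (Lc x).
have := ler_wpM2r (qf1_ge0 x) (ler_wpM2l (ltW h0) hK).
by rewrite expr2; lra.
Qed.

(** A quantitative strict Lyapunov function. One constant for both inequalities lets a certificate
    survive small shifts and block sums by taking a minimum. *)
Definition stability_cert A N V c :=
  [/\ V^T = V, 0 < c, forall x, c * qf 1%:M x <= qf V x &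
      forall x, qf (gen_lyapunov gamma A N V) x <= - c * qf 1%:M x].

Lemma cert_psd A N V c : stability_cert A N V c -> psd V.
Proof.
case=> _ c0 cV _ x; apply: le_trans (cV x).
exact: mulr_ge0 (ltW c0) (qf1_ge0 x).
Qed.

(** Consider the least [s >= 0] with [W + s V] positive semidefinite. If it were positive, this
    matrix would have an image below [- s c], hence would be bounded below by a positive multiple of
    the identity, and [s] could still be lowered. *)
Lemma psd_of_gen_lyapunov_le0 A N V c W : stability_cert A N V c ->
  (forall x, qf (gen_lyapunov gamma A N W) x <= 0) -> psd W.
Proof.
move=> cert LW; have Vp := cert_psd cert; case: cert => _ c0 cV LV.
pose E : set R := [set s | 0 <= s /\ psd (W + s *: V)].
have E0 : E (nrm W / c).
  split; first exact: divr_ge0 (nrm_ge0 _) (ltW c0).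
  move=> x; rewrite qfD qfZ.
  have := ler_qf_nrm W x; rewrite ler_norml => /andP[lo _].
  have : nrm W / c * (c * qf 1%:M x) <= nrm W / c * qf V x.
    exact: ler_wpM2l (divr_ge0 (nrm_ge0 _) (ltW c0)) _ _ (cV x).
  by rewrite mulrA divfK ?gt_eqF//; lra.
have Ei : has_inf E by split; [exists (nrm W / c) | exists 0 => s []].
have inf0 : 0 <= inf E by apply: lb_le_inf; [case: Ei|move=> s []].
have infE : psd (W + inf E *: V).
  move=> x; rewrite qfD qfZ; apply/ler_addgt0Pr => e e0.
  have Vx1 : 0 < qf V x + 1 by have := Vp x; lra.
  have [s Es ltse] := inf_adherent (divr_gt0 e0 Vx1) Ei.
  have les : inf E <= s by apply: ge_inf => //; case: Ei.
  have [s0 /(_ x)] := Es; rewrite qfD qfZ => h1.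
  have h3 : (s - inf E) * (qf V x + 1) <= e.
    by rewrite -ler_pdivlMr// lerBlDl ltW.
  by have := Vp x; nra.
case: (ltrP 0 (inf E)) => [gt0|le0]; last first.
  have i0 : inf E = 0 by apply/le_anti/andP.
  by move=> x; have := infE x; rewrite i0 scale0r addr0.
have [e e0 he] : exists2 e, 0 < e &
    forall x, e * qf 1%:M x <= qf (W + inf E *: V) x.
  apply: (@psd_gen_lyapunov_lower A N _ (inf E * c)) => //; first exact: mulr_gt0.
  move=> x; rewrite qf_gen_lyapunovDZ.
  by have := LW x; have := LV x; have := qf1_ge0 x; nra.
pose K := nrm V + 1; have K0 : 0 < K by have := nrm_ge0 V; rewrite /K; lra.
(* The first bound keeps the lowered parameter nonnegative, the second makes [t V] smaller than the
   margin [e]. *)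
pose t := Num.min (inf E) (e / K).
have t0 : 0 < t by rewrite lt_min gt0 divr_gt0.
have : inf E <= inf E - t; last by lra.
apply: ge_inf; first by case: Ei.
split; first by rewrite subr_ge0 ge_min lexx.
move=> x; rewrite scalerBl addrA qfB qfZ subr_ge0; apply: le_trans (he x).
have tK : t * K <= e by rewrite -ler_pdivlMr// ge_min lexx orbT.
have := ler_qf_nrm V x; rewrite ler_norml => /andP[_ up].
have := Vp x; have := qf1_ge0 x; move: up tK t0; rewrite /K; move: (nrm V) (nrm_ge0 V) => k k0.
move: (qf V x) (qf 1%:M x) => a q up tK t0 q0 a0.
have : t * a <= t * (k * q) by rewrite ler_wpM2l// ltW.
have : t * k * q <= e * q by rewrite ler_wpM2r//; nra.
lra.
Qed.

End GenLyapunov.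

(** * Existence of stability certificates *)

Section StabilityCertificate.
Variable R : realType.

Lemma ler_nrm m n (M : 'M[R]_(m, n)) i j : `|M i j| <= nrm M.
Proof.
rewrite /nrm (bigD1 i) //= (bigD1 j) //= -addrA lerDl addr_ge0 ?sumr_ge0//.
by move=> *; apply: sumr_ge0.
Qed.

(** In finite dimension injectivity alone yields surjectivity and a bound on the inverse; the latter
    is the resolvent estimate used for [stability_cert_exists]. *)
Lemma linear_inj_bij m n (f : 'M[R]_(m, n) -> 'M[R]_(m, n)) : linear f ->
  (forall W, f W = 0 -> W = 0) ->
  (exists2 b, 0 <= b & forall W, nrm W <= b * nrm (f W)) /\
  (forall G, exists W, f W = G).
Proof.
move=> lf inj.
pose F : {linear 'M[R]_(m, n) -> 'M[R]_(m, n)} :=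
  HB.pack f (GRing.isLinear.Build _ _ _ _ f lf).
have FE W : mxvec W *m lin_mx F = mxvec (f W) by rewrite mul_vec_lin.
have uB : lin_mx F \in unitmx.
  rewrite -row_free_unit; apply: inj_row_free => v.
  rewrite -[v]vec_mxK FE => /(congr1 vec_mx); rewrite mxvecK linear0.
  by move=> /inj ->; rewrite linear0.
have invF W : mxvec W = mxvec (f W) *m invmx (lin_mx F) by rewrite -FE mulmxK.
split; last first.
  move=> G; exists (vec_mx (mxvec G *m invmx (lin_mx F))).
  by apply: (can_inj mxvecK); rewrite -FE vec_mxK mulmxKV.
set B := invmx _ in invF.
exists (\sum_i \sum_j \sum_l `|B l (mxvec_index i j)|).
  by do 3! (apply: sumr_ge0 => ? _).
move=> W; rewrite {1}/nrm mulr_suml; apply: ler_sum => i _.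
rewrite mulr_suml; apply: ler_sum => j _; rewrite mulr_suml.
rewrite -mxvecE invF mxE (le_trans (ler_norm_sum _ _ _))//.
apply: ler_sum => l _; rewrite normrM mulrC ler_wpM2l//.
by case/mxvec_indexP: l => i' j'; rewrite mxvecE ler_nrm.
Qed.

Variables (n m : nat) (gamma : R).
Implicit Types (A V W G P : 'M[R]_n) (N : 'I_m -> 'M[R]_n).
Local Notation gl := (gen_lyapunov gamma).
Local Notation stability_cert := (stability_cert gamma).

(** Injectivity is known on symmetric matrices only, and these do not form a full matrix space.
    Since the operator commutes with transposition, it can be replaced by minus the identity on
    antisymmetric matrices; the resulting map [f] is injective everywhere. *)
Lemma gen_lyapunov_sym_inj_bij A N :
  (forall V, V^T = V -> gl A N V = 0 -> V = 0) ->
  (exists2 b, 0 <= b & forall W, W^T = W -> nrm W <= b * nrm (gl A N W)) /\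
  (forall G, G^T = G -> exists2 W, W^T = W & gl A N W = G).
Proof.
move=> inj.
pose sy W := 2^-1 *: (W + W^T); pose an W := 2^-1 *: (W - W^T).
have half X : 2^-1 *: (X + X) = X :> 'M[R]_n.
  by rewrite scalerDr -scalerDl (_ : 2^-1 + 2^-1 = 1) ?scale1r//; lra.
have syan W : W = sy W + an W.
  by rewrite /sy /an -scalerDr addrACA subrr addr0 half.
have syT W : (sy W)^T = sy W by rewrite /sy linearZ /= raddfD /= trmxK addrC.
have anT W : (an W)^T = - an W.
  by rewrite /an linearZ /= raddfB /= trmxK -opprB scalerN.
have sy_sym W : W^T = W -> sy W = W.
  by move=> sW; rewrite /sy sW half.
have an_sym W : W^T = W -> an W = 0 by move=> sW; rewrite /an sW subrr scaler0.
pose f W := gl A N (sy W) - an W.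
have f_sym W : W^T = W -> f W = gl A N W.
  by move=> sW; rewrite /f sy_sym// an_sym// subr0.
have fsy W : sy (f W) = gl A N (sy W).
  rewrite {1}/sy /f raddfB /= gen_lyapunov_tr syT anT opprK addrACA addNr addr0.
  exact: half.
have lf : linear f.
  move=> a U W; rewrite /f.
  have trE : (a *: U + W)^T = a *: U^T + W^T by rewrite raddfD /= linearZ.
  have -> : sy (a *: U + W) = a *: sy U + sy W.
    rewrite /sy trE addrACA -scalerDr [LHS]scalerDr !scalerA.
    by rewrite [a * _]mulrC.
  have -> : an (a *: U + W) = a *: an U + an W.
    rewrite /an trE opprD addrACA -scalerN -scalerDr.
    by rewrite [LHS]scalerDr !scalerA [a * _]mulrC.
  by rewrite gen_lyapunov_linear scalerBr opprD addrACA.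
have finj W : f W = 0 -> W = 0.
  move=> fW0; have : gl A N (sy W) = 0.
    by rewrite -fsy fW0 /sy trmx0 addr0 scaler0.
  move=> /(inj _ (syT W)) sW0; move: fW0.
  rewrite /f sW0 gen_lyapunov0 sub0r => /eqP; rewrite oppr_eq0 => /eqP aW0.
  by rewrite (syan W) sW0 aW0 addr0.
have [[b b0 hb] surj] := linear_inj_bij lf finj; split.
  by exists b => // W sW; rewrite -f_sym.
move=> G sG; have [W fW] := surj G; exists (sy W) => //.
by rewrite -fsy fW sy_sym.
Qed.

(** A kernel element and its opposite both have a nonpositive image, so both are positive
    semidefinite. *)
Lemma cert_sym_inj A N V c : stability_cert A N V c ->
  forall W, W^T = W -> gl A N W = 0 -> W = 0.
Proof.
move=> cert W sW W0; apply: sym_qf0 => // x; apply/le_anti/andP; split.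
  have /(_ x) : psd (- W); last by rewrite qfN oppr_ge0.
  apply: (psd_of_gen_lyapunov_le0 cert) => y.
  by rewrite gen_lyapunovN W0 qfN qf0 oppr0.
by apply: (psd_of_gen_lyapunov_le0 cert) => y; rewrite W0 qf0.
Qed.

(* The set of shifts [s] for which [L - s] has a certificate is an up-set;
   resolvent bounds at its infimum show that it is open, hence contains 0. *)
Lemma stability_cert_exists A N :
  (forall s, 0 <= s -> forall V, V^T = V -> gl A N V = s *: V -> V = 0) ->
  exists V c, stability_cert A N V c.
Proof.
move=> inj; pose As s := A - (s / 2)%:M.
have glE s V : gl (As s) N V = gl A N V - s *: V.
  by rewrite gen_lyapunov_shift mulrC divfK ?pnatr_eq0.
pose E : set R := [set s | 0 <= s /\ exists V c, stability_cert (As s) N V c].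
(* For a shift this large the identity matrix is already a certificate. *)
have E1 : E (nrm (gl A N 1%:M) + 1).
  split; first by rewrite addr_ge0 ?nrm_ge0.
  exists 1%:M, 1; split => //; first by rewrite trmx1.
    by move=> x; rewrite mul1r.
  move=> x; rewrite glE qfB qfZ.
  have := ler_qf_nrm (gl A N 1%:M) x; rewrite ler_norml => /andP[_].
  by lra.
have Ei : has_inf E by split; [exists (nrm (gl A N 1%:M) + 1) | exists 0 => s []].
have inf0 : 0 <= inf E by apply: lb_le_inf; [case: Ei|move=> s []].
have inji V : V^T = V -> gl (As (inf E)) N V = 0 -> V = 0.
  by move=> sV; rewrite glE => /eqP; rewrite subr_eq0 => /eqP; exact: inj.
have [[b b0 hb] _] := gen_lyapunov_sym_inj_bij inji.
(* A solution of [(L - s) V = - I] with [s] within [1 / (2 (b + 1))] of the infimum satisfies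
   [nrm V <= b nrm I + nrm V / 2], hence [nrm V <= B]. This bound is independent of [s], so the
   decrement [eta] can be fixed before [s] is chosen. *)
pose B := 2 * b * nrm (1%:M : 'M[R]_n).
have B0 : 0 <= B by rewrite !mulr_ge0 ?nrm_ge0.
pose eta := (2 * (B + 1))^-1.
have eta0 : 0 < eta by rewrite invr_gt0; lra.
pose e := Num.min eta (2 * (b + 1))^-1.
have e0 : 0 < e by rewrite lt_min eta0 invr_gt0; lra.
have [s Es ltse] := inf_adherent e0 Ei.
have les : inf E <= s by apply: ge_inf => //; case: Ei.
have [s0 [V0 [c0 cert]]] := Es.
have [_ surj] := gen_lyapunov_sym_inj_bij (cert_sym_inj cert).
have s1 : (- 1%:M : 'M[R]_n)^T = - 1%:M by rewrite raddfN /= trmx1.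
have [V sV] := surj _ s1; rewrite glE => LV.
have Vp : psd V.
  apply: (psd_of_gen_lyapunov_le0 cert) => x; rewrite glE LV qfN.
  by rewrite oppr_le0 qf1_ge0.
have nV : nrm V <= B.
  have := hb V sV; rewrite glE.
  have -> : gl A N V - inf E *: V = (- 1) *: 1%:M + (s - inf E) *: V.
    by rewrite scaleN1r -LV scalerBl addrA subrK.
  have := nrmD ((- 1) *: (1%:M : 'M[R]_n)) ((s - inf E) *: V).
  rewrite !nrmZ normrN normr1 mul1r ger0_norm ?subr_ge0// => h1 h2.
  have sb : (s - inf E) * b <= 2^-1.
    have : s - inf E <= (2 * (b + 1))^-1.
      by rewrite lerBlDl (le_trans (ltW ltse))// lerD2l ge_min lexx orbT.
    move=> /(ler_wpM2r b0) /le_trans; apply.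
    by rewrite mulrC ler_pdivrMr; lra.
  have := ler_wpM2l b0 h1; have := ler_wpM2r (nrm_ge0 V) sb.
  by rewrite /B; lra.
(* [(L - s') V = - I + (s - s') V], and [eta B <= 1 / 2] leaves half of the negativity. *)
pose s' := Num.max 0 (s - eta).
have LV' x : qf (gl (As s') N V) x <= - 2^-1 * qf 1%:M x.
  have -> : gl (As s') N V = - 1%:M + (s - s') *: V.
    by rewrite glE -LV scalerBl addrA subrK.
  rewrite qfD qfN qfZ.
  have ss' : s - s' <= eta by rewrite lerBlDl -lerBlDr le_max lexx orbT.
  have h1 := ler_wpM2r (Vp x) ss'.
  have := ler_qf_nrm V x; rewrite ler_norml => /andP[_] h2.
  have h3 := ler_wpM2r (qf1_ge0 x) nV.
  have h4 := ler_wpM2l (ltW eta0) (le_trans h2 h3).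
  have h5 : eta * B <= 2^-1 by rewrite mulrC ler_pdivrMr; lra.
  have := ler_wpM2r (qf1_ge0 x) h5.
  by lra.
have hf : 0 < 2^-1 :> R by rewrite invr_gt0.
have [k k0 hk] := psd_gen_lyapunov_lower hf Vp LV'.
(* If [eta < s], the shift [s - eta] would belong to [E] below its infimum; otherwise the lowered
   shift is 0, which is the claim. *)
case: (ltrP eta s) => [lt|le].
  suff : inf E <= s - eta.
    have : e <= eta by rewrite ge_min lexx.
    by move: ltse; move: (inf E) (e) => i f; lra.
  apply: ge_inf; first by case: Ei.
  have es' : s' = s - eta by rewrite /s' max_r// subr_ge0 ltW.
  split; first by rewrite subr_ge0 ltW.
  rewrite -es'; exists V, (Num.min k 2^-1); split => //.
  - by rewrite lt_min k0.
  - by move=> x; apply: le_trans (hk x); rewrite ler_wpM2r ?qf1_ge0 ?ge_min ?lexx.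
  move=> x; apply: (le_trans (LV' x)).
  by rewrite ler_wpM2r ?qf1_ge0// lerN2 ge_min lexx orbT.
have es' : s' = 0 by rewrite /s' max_l// subr_le0.
exists V, (Num.min k 2^-1); split => //.
- by rewrite lt_min k0.
- by move=> x; apply: le_trans (hk x); rewrite ler_wpM2r ?qf1_ge0 ?ge_min ?lexx.
move=> x; have := LV' x; rewrite es' glE scale0r subr0 => /le_trans; apply.
by rewrite ler_wpM2r ?qf1_ge0// lerN2 ge_min lexx orbT.
Qed.

Lemma mxtrace_gen_lyapunov_adj A N W P :
  \tr (W *m gl A N P) = \tr (gl A^T (fun k => (N k)^T) W *m P).
Proof.
rewrite !gen_lyapunovE mulmxDr [in RHS]mulmxDl !mxtraceD; congr (_ + _).
  rewrite mulmxDr [in RHS]mulmxDl !mxtraceD trmxK addrC !mulmxA.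
  by rewrite mxtrace_mulC !mulmxA.
rewrite -scalemxAr -scalemxAl !mxtraceZ; congr (_ * _).
rewrite mulmx_sumr mulmx_suml !raddf_sum /=; apply: eq_bigr => k _.
by rewrite mulmxA mxtrace_mulC trmxK !mulmxA.
Qed.

Lemma mxtrace_sqr_eq0 P : P^T = P -> \tr (P *m P) = 0 -> P = 0.
Proof.
move=> sP t0; apply/matrixP => i j; rewrite mxE; apply/eqP.
have : \sum_i \sum_j P i j ^+ 2 = 0.
  rewrite -[RHS]t0; apply: eq_bigr => k _; rewrite mxE; apply: eq_bigr => l _.
  by rewrite -{3}sP mxE.
move=> /eqP; rewrite psumr_eq0 => [/allP/(_ i (mem_index_enum _))|k _]; last first.
  by apply: sumr_ge0 => l _; exact: sqr_ge0.
rewrite /= psumr_eq0 => [/allP/(_ j (mem_index_enum _))|k _]; last exact: sqr_ge0.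
by rewrite /= sqrf_eq0.
Qed.

(** Fredholm alternative: if [L P = s P] with [s >= 0] and [P] symmetric, the shifted adjoint keeps
    its certificate and is therefore onto the symmetric matrices. Writing [P] as its value at some
    [W] gives [tr (P P) = tr (W (L - s) P) = 0]. *)
Lemma stability_cert_adj A N V c :
  stability_cert A^T (fun k => (N k)^T) V c ->
  exists V' c', stability_cert A N V' c'.
Proof.
move=> [sV c0 cV LV]; apply: stability_cert_exists => s s0 P sP LP.
apply: mxtrace_sqr_eq0 => //.
have cert : stability_cert (A^T - (s / 2)%:M) (fun k => (N k)^T) V c.
  split => // x; rewrite gen_lyapunov_shift qfB qfZ.
  apply: le_trans (LV x); rewrite lerBlDr lerDl.
  have Vx : 0 <= qf V x.
    by apply: le_trans (cV x); exact: mulr_ge0 (ltW c0) (qf1_ge0 x).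
  by rewrite mulr_ge0// mulr_ge0// divr_ge0.
have [_ surj] := gen_lyapunov_sym_inj_bij (cert_sym_inj cert).
have [W sW {1}<-] := surj P sP.
have -> : A^T - (s / 2)%:M = (A - (s / 2)%:M)^T.
  by rewrite raddfB /= tr_scalar_mx.
rewrite -mxtrace_gen_lyapunov_adj gen_lyapunov_shift LP.
by rewrite mulrC divfK ?pnatr_eq0// subrr mulmx0 raddf0.
Qed.

End StabilityCertificate.

(** * Kronecker spectrum and reduced matrices *)

Section KroneckerSpectrum.
Variable R : realType.

(** [eigenvalue] refers to row vectors, and multiplying the row of entries of [V] by [A1 *t A2]
    produces the entries of [A1^T V A2]. This is why the adjoint operator appears here. *)
Lemma gen_lyapunov_kron_eigen n m gamma (A : 'M[R]_n) (N : 'I_m -> 'M[R]_n) s V :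
  gen_lyapunov gamma A^T (fun k => (N k)^T) V = s *: V -> V != 0 ->
  eigenvalue (kron_lyapunov gamma A N) s.
Proof.
move=> LV V0; apply/eigenvalueP.
pose v : 'rV[R]_(n * n) := \row_k V (mxtens_unindex k).1 (mxtens_unindex k).2.
exists v; last first.
  apply: contra V0 => /eqP v0; apply/eqP/matrixP => i j.
  by have /rowP/(_ (mxtens_index (i, j))) := v0; rewrite !mxE mxtens_indexK.
have vtens (A1 A2 : 'M[R]_n) i j :
    (v *m (A1 *t A2)) 0 (mxtens_index (i, j)) = (A1^T *m V *m A2) i j.
  rewrite mxE (reindex (@mxtens_index n n)) /=; last first.
    by exists (@mxtens_unindex n n) => k _; rewrite (mxtens_indexK, mxtens_unindexK).
  rewrite (eq_bigr (fun p => V p.1 p.2 * (A1 p.1 i * A2 p.2 j))); last first.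
    by move=> [k l] _; rewrite tensmxE mxE mxtens_indexK.
  rewrite -(pair_bigA _ (fun k l => V k l * (A1 k i * A2 l j))) /=.
  rewrite exchange_big mxE; apply: eq_bigr => l _.
  rewrite mxE big_distrl; apply: eq_bigr => k _ /=.
  by rewrite mxE; ring.
apply/rowP => k; case: (mxtens_indexP k) => i j.
have /matrixP/(_ i j) := LV; rewrite gen_lyapunovE !trmxK => e.
rewrite /kron_lyapunov !mulmxDr -scalemxAr mulmx_sumr.
rewrite [RHS]mxE [v _ _]mxE mxtens_indexK /=.
have -> : s * V i j = (s *: V) i j by rewrite mxE.
have mD k1 k2 (M1 M2 : 'M[R]_(k1, k2)) x y : (M1 + M2) x y = M1 x y + M2 x y.
  by rewrite mxE.
rewrite -e !mD !vtens trmx1 mul1mx mulmx1.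
congr (_ + _); rewrite mxE [RHS]mxE; congr (_ * _).
rewrite !summxE; apply: eq_bigr => l _.
by rewrite vtens trmxK.
Qed.

End KroneckerSpectrum.

(** * Compression to the reduced matrices and the trace identity *)

Section ReducedIdentities.
Variables (R : realType) (r d m : nat) (gamma : R).
Variables (A : 'M[R]_(r + d)) (N : 'I_m -> 'M[R]_(r + d)) (meth : reduction).
Hypothesis A22_unit : meth = SPA -> drsubmx A \in unitmx.

Let At := red_A meth A.
Let Nt k := red_N meth A (N k).
Let a := bold_A21 meth A.
Let b := bold_A21_bar meth A.
Let n k := bold_N21 meth A (N k).

(* [A *m red_lift], [N k *m red_lift] and [C *m red_lift] have the reduced matrices as
   their upper blocks, which treats both reduction methods at once. *)
Definition red_lift : 'M[R]_(r + d, r) := col_mx 1%:M b.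

Lemma mul_lift_A : A *m red_lift = col_mx At a.
Proof.
rewrite -{1}[A]submxK mul_block_col !mulmx1 /At /a /b.
case: meth A22_unit => [_|/(_ erefl) u] /=; first by rewrite !mulmx0 !addr0.
by rewrite !mulmxN !mulmxA mulmxV// mul1mx subrr.
Qed.

Lemma mul_lift_N k : N k *m red_lift = col_mx (Nt k) (n k).
Proof.
rewrite -{1}[N k]submxK mul_block_col !mulmx1 /Nt /n /b.
by case: meth => /=; rewrite ?mulmx0 ?addr0// !mulmxN !mulmxA.
Qed.

Lemma mul_lift_C p (C : 'M[R]_(p, r + d)) : C *m red_lift = red_C meth A C.
Proof.
rewrite -{1}[C]hsubmxK mul_row_col mulmx1 /b.
by case: meth => /=; rewrite ?mulmx0 ?addr0// !mulmxN !mulmxA.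
Qed.

(** For each method one of the two factors is zero; this removes the cross terms that would
    otherwise separate the two reductions. *)
Lemma bold_mul0 (M : 'M[R]_d) : a^T *m M *m b = 0.
Proof.
by rewrite /a /b; case: meth => /=; rewrite ?mulmx0// trmx0 !mul0mx.
Qed.

Lemma bold_mul0' (M : 'M[R]_r) : a *m M *m b^T = 0.
Proof.
by rewrite /a /b; case: meth => /=; rewrite ?trmx0 ?mulmx0// !mul0mx.
Qed.

(** The observability equation survives reduction as an inequality: compressing it by [red_lift]
    gives the reduced adjoint operator at [T1] plus a term that is nonnegative when [T2] is. *)
Lemma red_gen_lyapunov_adj (T1 : 'M[R]_r) (T2 : 'M[R]_d) :
  gen_lyapunov gamma At^T (fun k => (Nt k)^T) T1 =
  red_lift^T *m gen_lyapunov gamma A^T (fun k => (N k)^T) (block_mx T1 0 0 T2) *m red_lift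
  - gamma ^- 2 *: \sum_k (n k)^T *m T2 *m n k.
Proof.
set Th := block_mx _ _ _ _.
have e1 (U1 W1 : 'M[R]_r) (U2 W2 : 'M[R]_(d, r)) :
    (col_mx U1 U2)^T *m Th *m col_mx W1 W2 =
    U1^T *m T1 *m W1 + U2^T *m T2 *m W2.
  rewrite tr_col_mx /Th mul_row_block mul_row_col !mulmx0 addr0 add0r.
  by [].
rewrite !gen_lyapunovE mulmxDr mulmxDl mulmxDr mulmxDl !trmxK.
have -> : red_lift^T *m (A^T *m Th) *m red_lift = At^T *m T1.
  rewrite mulmxA -trmx_mul mul_lift_A e1 mulmx1.
  by rewrite bold_mul0 addr0.
have -> : red_lift^T *m (Th *m A) *m red_lift = T1 *m At.
  rewrite mulmxA -mulmxA mul_lift_A e1 trmx1 mul1mx.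
  have -> : b^T *m T2 *m a = (a^T *m T2^T *m b)^T.
    by rewrite !trmx_mul !trmxK mulmxA.
  by rewrite bold_mul0 trmx0 addr0.
rewrite -!addrA; congr (_ + (_ + _)); rewrite -scalemxAr -scalemxAl -scalerBr.
congr (_ *: _); rewrite mulmx_sumr mulmx_suml -sumrB; apply: eq_bigr => k _.
have -> : red_lift^T *m ((N k)^T *m Th *m (N k)^T^T) *m red_lift =
    (N k *m red_lift)^T *m Th *m (N k *m red_lift) by rewrite trmxK trmx_mul !mulmxA.
by rewrite mul_lift_N e1 trmxK addrK.
Qed.

(** As [red_C] is [C *m red_lift], each of the three traces has the form
    [tr (C E C^T) = - tr (Th L(E))], where [E] is [Th], [Y red_lift^T] or [red_lift P red_lift^T].
    Since [Th] is block diagonal, only the diagonal blocks of [L(E)] count. The three upper left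
    blocks coincide and cancel with the weights 1, -2, 1; the lower right ones add up to [W_x0], up
    to sign. *)
Lemma red_trace_identity p q (C : 'M[R]_(p, r + d)) (X : 'M[R]_(r + d, q))
    (T1 : 'M[R]_r) (T2 : 'M[R]_d) (Y : 'M[R]_(r + d, r)) (P : 'M[R]_r) :
  let Th := block_mx T1 0 0 T2 in
  gen_lyapunov gamma A N Th = - (X *m X^T) ->
  gen_lyapunov gamma A^T (fun k => (N k)^T) Th = - (C^T *m C) ->
  gen_sylvester gamma A N At Nt Y = - (X *m (usubmx X)^T) ->
  gen_lyapunov gamma At Nt P = - (usubmx X *m (usubmx X)^T) ->
  \tr (C *m Th *m C^T) - 2 * \tr (C *m Y *m (red_C meth A C)^T)
    + \tr (red_C meth A C *m P *m (red_C meth A C)^T)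
  = \tr (T2 *m W_x0 meth gamma A N X Y P).
Proof.
move=> Th LTh LTh' SY LP.
have trC (E : 'M[R]_(r + d)) : \tr (C *m E *m C^T) = - \tr (Th *m gen_lyapunov gamma A N E).
  rewrite mxtrace_gen_lyapunov_adj LTh' mulNmx raddfN /= opprK.
  by rewrite mxtrace_mulC mulmxA.
have trTh (E : 'M[R]_(r + d)) :
    \tr (Th *m E) = \tr (T1 *m ulsubmx E) + \tr (T2 *m drsubmx E).
  rewrite -{1}[E]submxK mulmx_block mxtrace_block !mul0mx.
  by rewrite addr0 add0r.
rewrite -(mul_lift_C C) !trmx_mul !mulmxA.
have -> : C *m Y *m red_lift^T *m C^T = C *m (Y *m red_lift^T) *m C^T by rewrite !mulmxA.
have -> : C *m red_lift *m P *m red_lift^T *m C^T = C *m (red_lift *m P *m red_lift^T) *m C^T.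
  by rewrite !mulmxA.
rewrite !trC !trTh LTh.
have colrow (U1 : 'M[R]_r) (Z : 'M[R]_(r + d, r)) (U2 : 'M[R]_(d, r)) :
    Z *m (col_mx U1 U2)^T = block_mx (usubmx Z *m U1^T) (usubmx Z *m U2^T)
                                     (dsubmx Z *m U1^T) (dsubmx Z *m U2^T).
  by rewrite -{1}[Z]vsubmxK tr_col_mx mul_col_row.
have LY : gen_lyapunov gamma A N (Y *m red_lift^T) =
    A *m Y *m red_lift^T + Y *m (col_mx At a)^T
    + gamma ^- 2 *: \sum_k N k *m Y *m (col_mx (Nt k) (n k))^T.
  rewrite gen_lyapunovE !mulmxA -mul_lift_A trmx_mul mulmxA; congr (_ + _ *: _).
  by apply: eq_bigr => k _; rewrite -mul_lift_N trmx_mul !mulmxA.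
have LPt : gen_lyapunov gamma A N (red_lift *m P *m red_lift^T) =
    col_mx At a *m P *m red_lift^T + red_lift *m P *m (col_mx At a)^T
    + gamma ^- 2 *: \sum_k col_mx (Nt k) (n k) *m P *m (col_mx (Nt k) (n k))^T.
  rewrite gen_lyapunovE !mulmxA -mul_lift_A trmx_mul !mulmxA; congr (_ + _ *: _).
  by apply: eq_bigr => k _; rewrite -mul_lift_N trmx_mul !mulmxA.
have ulE (U1 : 'M[R]_r) (Z : 'M[R]_(r + d, r)) (U2 : 'M[R]_(d, r)) :
  ulsubmx (Z *m (col_mx U1 U2)^T) = usubmx Z *m U1^T.
  by rewrite colrow block_mxKul.
have drE (U1 : 'M[R]_r) (Z : 'M[R]_(r + d, r)) (U2 : 'M[R]_(d, r)) :
  drsubmx (Z *m (col_mx U1 U2)^T) = dsubmx Z *m U2^T.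
  by rewrite colrow block_mxKdr.
have ul3 (M1 M2 : 'M[R]_(r + d)) F : ulsubmx (M1 + M2 + gamma ^- 2 *: \sum_(k < m) F k) =
    ulsubmx M1 + ulsubmx M2 + gamma ^- 2 *: \sum_(k < m) ulsubmx (F k).
  apply/matrixP => i j; rewrite !mxE !summxE; congr (_ + _ * _).
  by apply: eq_bigr => k _; rewrite !mxE.
have dr3 (M1 M2 : 'M[R]_(r + d)) F : drsubmx (M1 + M2 + gamma ^- 2 *: \sum_(k < m) F k) =
    drsubmx M1 + drsubmx M2 + gamma ^- 2 *: \sum_(k < m) drsubmx (F k).
  apply/matrixP => i j; rewrite !mxE !summxE; congr (_ + _ * _).
  by apply: eq_bigr => k _; rewrite !mxE.
have us3 (M1 M2 : 'M[R]_(r + d, r)) F : usubmx (M1 + M2 + gamma ^- 2 *: \sum_(k < m) F k) =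
    usubmx M1 + usubmx M2 + gamma ^- 2 *: \sum_(k < m) usubmx (F k).
  apply/matrixP => i j; rewrite !mxE !summxE; congr (_ + _ * _).
  by apply: eq_bigr => k _; rewrite !mxE.
have uXX : usubmx (X *m (usubmx X)^T) = usubmx X *m (usubmx X)^T.
  by rewrite mul_usub_mx.
have ulY : ulsubmx (gen_lyapunov gamma A N (Y *m red_lift^T)) = - (usubmx X *m (usubmx X)^T).
  rewrite -uXX -[RHS]raddfN /= -SY /gen_sylvester LY ul3 us3 !ulE trmx1 mulmx1.
  rewrite mul_usub_mx; congr (_ + _ *: _).
  by apply: eq_bigr => k _; rewrite ulE mul_usub_mx.
have drY : drsubmx (gen_lyapunov gamma A N (Y *m red_lift^T)) =
    dsubmx A *m Y *m b^T + dsubmx Y *m a^T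
    + gamma ^- 2 *: \sum_k dsubmx (N k) *m Y *m (n k)^T.
  rewrite LY dr3 !drE -(mul_dsub_mx A Y); congr (_ + _ *: _).
  by apply: eq_bigr => k _; rewrite drE -(mul_dsub_mx (N k) Y).
have ulP : ulsubmx (gen_lyapunov gamma A N (red_lift *m P *m red_lift^T)) =
    - (usubmx X *m (usubmx X)^T).
  rewrite -LP LPt ul3 !ulE trmx1 mulmx1 -!mul_usub_mx !col_mxKu mul1mx.
  rewrite gen_lyapunovE; congr (_ + _ *: _).
  by apply: eq_bigr => k _; rewrite ulE -mul_usub_mx col_mxKu.
have drP : drsubmx (gen_lyapunov gamma A N (red_lift *m P *m red_lift^T)) =
    gamma ^- 2 *: \sum_k n k *m P *m (n k)^T.
  rewrite LPt dr3 !drE -!mul_dsub_mx !col_mxKd bold_mul0'.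
  have -> : b *m P *m a^T = (a *m P^T *m b^T)^T by rewrite !trmx_mul !trmxK mulmxA.
  rewrite bold_mul0' trmx0 !add0r; congr (_ *: _).
  by apply: eq_bigr => k _; rewrite drE -mul_dsub_mx col_mxKd.
have ulX : ulsubmx (- (X *m X^T)) = - (usubmx X *m (usubmx X)^T).
  by rewrite -{1 2}[X]vsubmxK tr_col_mx mul_col_row opp_block_mx block_mxKul.
have drX : drsubmx (- (X *m X^T)) = - (dsubmx X *m (dsubmx X)^T).
  by rewrite -{1 2}[X]vsubmxK tr_col_mx mul_col_row opp_block_mx block_mxKdr.
rewrite ulY drY ulP drP ulX drX /W_x0 -/a -/b.
have -> : \sum_k (2 *: (dsubmx (N k) *m Y *m (bold_N21 meth A (N k))^T) -
    bold_N21 meth A (N k) *m P *m (bold_N21 meth A (N k))^T) =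
    2 *: \sum_k dsubmx (N k) *m Y *m (n k)^T - \sum_k n k *m P *m (n k)^T.
  by rewrite scaler_sumr -sumrB.
rewrite !mulmxDr !mulmxN -!scalemxAr !mulmxDr !mulmxN -!scalemxAr.
rewrite !(mxtraceD, mxtraceZ, raddfN) /=.
by ring.
Qed.

End ReducedIdentities.

(** * The coupled Gramian *)

Section ExtendedGramian.
Variable R : realType.

Lemma qf_block n r (M1 : 'M[R]_n) (M2 : 'M[R]_r) x y :
  qf (block_mx M1 0 0 M2) (col_mx x y) = qf M1 x + qf M2 y.
Proof.
by rewrite /qf tr_col_mx mul_row_block mul_row_col !mulmx0 addr0 add0r mxE.
Qed.

Lemma psd_gram n q (X : 'M[R]_(n, q)) : psd (X *m X^T).
Proof.
by move=> x; rewrite -[X in X *m _]mulmx1 qf_congr qf1_ge0.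
Qed.

Variables (m : nat) (gamma : R).

Lemma gen_lyapunov_block n r (A : 'M[R]_n) N (B : 'M[R]_r) K P Y Y' Z :
  gen_lyapunov gamma (block_mx A 0 0 B)
    (fun k : 'I_m => block_mx (N k) 0 0 (K k)) (block_mx P Y Y' Z) =
  block_mx (gen_lyapunov gamma A N P) (gen_sylvester gamma A N B K Y)
    (gen_sylvester gamma B K A N Y') (gen_lyapunov gamma B K Z).
Proof.
rewrite /gen_lyapunov {1}/gen_sylvester tr_block_mx !trmx0 !mulmx_block.
rewrite !mulmx0 !mul0mx !addr0 !add0r.
under eq_bigr => k _.
  rewrite tr_block_mx !trmx0 !mulmx_block !mulmx0 !mul0mx !addr0 !add0r.
  over.
have -> F1 F2 F3 F4 : \sum_(k < m) block_mx (F1 k) (F2 k) (F3 k) (F4 k) =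
    block_mx (\sum_k F1 k) (\sum_k F2 k) (\sum_k F3 k) (\sum_k F4 k)
    :> 'M[R]_(n + r).
  pose bE := (block_mxEul, block_mxEur, block_mxEdl, block_mxEdr).
  apply/matrixP => i j; rewrite summxE.
  by case: (split_ordP i) => {}i ->; case: (split_ordP j) => {}j ->;
    rewrite bE summxE; apply: eq_bigr => k _; rewrite bE.
by rewrite scale_block_mx !add_block_mx.
Qed.

Lemma gen_sylvester_tr n r (A : 'M[R]_n) (N : 'I_m -> 'M[R]_n) (B : 'M[R]_r) K Y :
  (gen_sylvester gamma A N B K Y)^T = gen_sylvester gamma B K A N Y^T.
Proof.
rewrite /gen_sylvester !raddfD /= linearZ /= raddf_sum /= !trmx_mul trmxK.
rewrite [_ *m A^T + _]addrC; congr (_ + _ *: _).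
by apply: eq_bigr => k _; rewrite !trmx_mul trmxK mulmxA.
Qed.

Lemma gen_sylvester_shift n r (A : 'M[R]_n) (N : 'I_m -> 'M[R]_n) (B : 'M[R]_r) K e Y :
  gen_sylvester gamma (A + e%:M) N (B - e%:M) K Y = gen_sylvester gamma A N B K Y.
Proof.
rewrite /gen_sylvester; congr (_ + _).
rewrite mulmxDl raddfB /= mulmxBr tr_scalar_mx mul_scalar_mx mul_mx_scalar.
by rewrite addrACA subrr addr0.
Qed.

(** Both diagonal certificates are known on the adjoint side, because [Theta1] comes from the
    observability equation. They are glued there, where the off-diagonal blocks stay zero, and the
    result is transferred by [stability_cert_adj]. *)
Lemma stability_cert_block n r (A : 'M[R]_n) N (B : 'M[R]_r) K V c W c1 c2 :
  stability_cert gamma A^T (fun k : 'I_m => (N k)^T) V c ->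
  W^T = W -> 0 < c1 -> (forall y, c1 * qf 1%:M y <= qf W y) -> 0 < c2 ->
  (forall y, qf (gen_lyapunov gamma B^T (fun k : 'I_m => (K k)^T) W) y
     <= - c2 * qf 1%:M y) ->
  exists V' c', stability_cert gamma (block_mx A 0 0 B)
    (fun k => block_mx (N k) 0 0 (K k)) V' c'.
Proof.
move=> [sV c0 cV LV] sW c10 cW c20 LW.
apply: (@stability_cert_adj _ _ _ _ _ _ (block_mx V 0 0 W) (Num.min c (Num.min c1 c2))).
have -> : (fun k => (block_mx (N k) 0 0 (K k))^T) =
    (fun k => block_mx (N k)^T 0 0 (K k)^T).
  by apply/funext => k; rewrite tr_block_mx !trmx0.
have q1 x y : qf 1%:M (col_mx x y) = qf 1%:M x + qf 1%:M y :> R.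
  by rewrite -qf_block -scalar_mx_block.
set c' := Num.min _ _.
have [le1 le2 le3] : [/\ c' <= c, c' <= c1 & c' <= c2].
  by split; rewrite !ge_min lexx ?orbT.
split.
- by rewrite tr_block_mx !trmx0 sV sW.
- by rewrite !lt_min c0 c10 c20.
- move=> z; rewrite -[z]vsubmxK; move: (usubmx z) (dsubmx z) => x y.
  rewrite qf_block q1; have := cV x; have := cW y.
  have := ler_wpM2r (qf1_ge0 x) le1; have := ler_wpM2r (qf1_ge0 y) le2; lra.
move=> z; rewrite -[z]vsubmxK; move: (usubmx z) (dsubmx z) => x y.
rewrite tr_block_mx !trmx0 gen_lyapunov_block.
have gs0 n1 n2 A1 N1 A2 N2 : gen_sylvester gamma A1 N1 A2 N2 0 = 0 :> 'M[R]_(n1, n2).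
  rewrite /gen_sylvester mulmx0 mul0mx big1 ?scaler0 ?addr0// => k _.
  by rewrite mulmx0 mul0mx.
rewrite !gs0 qf_block q1; have := LV x; have := LW y.
have := ler_wpM2r (qf1_ge0 x) le1; have := ler_wpM2r (qf1_ge0 y) le3; lra.
Qed.

(* Shifting [A] by [e] and [B] by [- e] leaves the mixed equation unchanged and
   makes the merely semistable block [B] strictly stable. *)
Lemma extended_gramian_psd n r q (A : 'M[R]_n) N (B : 'M[R]_r) K
    (X : 'M[R]_(n, q)) (Xt : 'M[R]_(r, q)) P Y Pt V c W c1 :
  stability_cert gamma A^T (fun k : 'I_m => (N k)^T) V c ->
  W^T = W -> 0 < c1 -> (forall y, c1 * qf 1%:M y <= qf W y) ->
  (forall y, qf (gen_lyapunov gamma B^T (fun k : 'I_m => (K k)^T) W) y <= 0) ->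
  gen_lyapunov gamma A N P = - (X *m X^T) ->
  gen_lyapunov gamma B K Pt = - (Xt *m Xt^T) -> psd Pt ->
  gen_sylvester gamma A N B K Y = - (X *m Xt^T) ->
  psd (block_mx P Y Y^T Pt).
Proof.
move=> cert sW c10 cW LW LP LPt Ptp LY.
have [V' [c' cert']] := stability_cert_adj cert.
have [_ surj] := gen_lyapunov_sym_inj_bij (cert_sym_inj cert').
have s1 : (- 1%:M : 'M[R]_n)^T = - 1%:M by rewrite raddfN /= trmx1.
(* Adding [t H] to [P] creates a slack [- t I] in the upper left block, which pays for the
   destabilizing shift of [A] by [e]. *)
have [H sH LH] := surj _ s1.
have psdt t : 0 < t -> psd (block_mx (P + t *: H) Y Y^T Pt).
  move=> t0; case: cert => sV c0 cV LV.
  set k1 := nrm (P + t *: H); have k10 : 0 <= k1 := nrm_ge0 _.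
  set k2 := nrm V; have k20 : 0 <= k2 := nrm_ge0 _.
  (* The first smallness condition gives [2 e (P + t H) <= t I]; the second keeps [V] a certificate
     for [A + e]. In the other block the shift only contributes [- 2 e Pt <= 0]. *)
  have [e [e0 e1 e2]] : exists e, [/\ 0 < e, 2 * e * k1 <= t & 2 * e * k2 <= c / 2].
    exists (Num.min (t / (2 * (k1 + 1))) (c / (4 * (k2 + 1)))); split.
    - by rewrite lt_min !divr_gt0// mulr_gt0//; lra.
    - apply: (@le_trans _ _ (2 * (t / (2 * (k1 + 1))) * k1)).
        by rewrite ler_wpM2r// ler_wpM2l// ge_min lexx.
      have -> : 2 * (t / (2 * (k1 + 1))) * k1 = t * k1 / (k1 + 1).
        by field; apply/eqP; lra.
      by rewrite ler_pdivrMr; nra.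
    apply: (@le_trans _ _ (2 * (c / (4 * (k2 + 1))) * k2)).
      by rewrite ler_wpM2r// ler_wpM2l// ge_min lexx orbT.
    have -> : 2 * (c / (4 * (k2 + 1))) * k2 = c / 2 * k2 / (k2 + 1).
      by field; apply/eqP; lra.
    by rewrite ler_pdivrMr; nra.
  have certe : stability_cert gamma (A + e%:M)^T (fun k : 'I_m => (N k)^T) V (Num.min c (c / 2)).
    have -> : (A + e%:M)^T = A^T - (- e)%:M.
      by rewrite raddfD /= tr_scalar_mx [(- e)%:M]raddfN opprK.
    split => //; first by rewrite lt_min c0 divr_gt0.
      move=> x; apply: le_trans (cV x).
      by rewrite ler_wpM2r ?qf1_ge0// ge_min lexx.
    move=> x; rewrite gen_lyapunov_shift qfB qfZ.
    have := ler_qf_nrm V x; rewrite ler_norml => /andP[_ h].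
    have h1 := ler_wpM2r (qf1_ge0 x) e2.
    have e00 : 0 <= 2 * e by lra.
    have h2 := ler_wpM2l e00 h.
    have h3 : Num.min c (c / 2) <= c / 2 by rewrite ge_min lexx orbT.
    have h4 := ler_wpM2r (qf1_ge0 x) h3.
    have := LV x; rewrite -/k2 in h2; lra.
  have c20 : 0 < 2 * e * c1 by rewrite !mulr_gt0.
  have [|Ve [ce certE]] := stability_cert_block (B := B - e%:M) (K := K) certe sW c10 cW c20.
    move=> y; rewrite raddfB /= tr_scalar_mx gen_lyapunov_shift qfB qfZ.
    have e00 : 0 <= 2 * e by lra.
    by have := LW y; have := ler_wpM2l e00 (cW y); lra.
  apply: (psd_of_gen_lyapunov_le0 certE) => z.
  rewrite gen_lyapunov_block gen_sylvester_shift LY.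
  have -> : gen_sylvester gamma (B - e%:M) K (A + e%:M) N Y^T = - (Xt *m X^T).
    rewrite -gen_sylvester_tr gen_sylvester_shift LY raddfN /= trmx_mul trmxK.
    by [].
  have -> : A + e%:M = A - (- e)%:M by rewrite [(- e)%:M]raddfN opprK.
  rewrite !gen_lyapunov_shift gen_lyapunovD gen_lyapunovZ LP LH LPt.
  set G := block_mx _ _ _ _.
  have -> : G = - (col_mx X Xt *m (col_mx X Xt)^T) +
      block_mx (2 * e *: (P + t *: H) - t%:M) 0 0 (- ((2 * e) *: Pt)).
    rewrite tr_col_mx mul_col_row opp_block_mx add_block_mx /G !addr0.
    congr block_mx; rewrite -addrA; congr (_ + _).
    by rewrite scalerN scalemx1 mulrN scaleNr opprK addrC.
  rewrite qfD qfN; have := psd_gram (col_mx X Xt) z.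
  rewrite -[in qf (block_mx _ _ _ _) _](vsubmxK z).
  move: (usubmx z) (dsubmx z) => x y.
  rewrite qf_block qfB qfN !qfZ qf_scalarmx.
  have := ler_qf_nrm (P + t *: H) x; rewrite ler_norml -/k1 => /andP[_ h].
  have e00 : 0 <= 2 * e by lra.
  have h1 := ler_wpM2l e00 h; have := ler_wpM2r (qf1_ge0 x) e1.
  have := mulr_ge0 e00 (Ptp y).
  by lra.
move=> z; apply/ler_addgt0Pr => e e0.
set k := nrm H; have k0 : 0 <= k := nrm_ge0 _.
rewrite -[z]vsubmxK; move: (usubmx z) (dsubmx z) => x y.
(* Only the upper left block was perturbed, and for this [t] its contribution at [x] is at most
   [e]. *)
pose t := e / (k * qf 1%:M x + 1).
have kq : 0 <= k * qf 1%:M x := mulr_ge0 k0 (qf1_ge0 x).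
have t0 : 0 < t by rewrite divr_gt0//; lra.
have := psdt t t0 (col_mx x y).
have -> : block_mx (P + t *: H) Y Y^T Pt =
    block_mx P Y Y^T Pt + block_mx (t *: H) 0 0 0.
  by rewrite add_block_mx !addr0.
rewrite qfD qf_block qf0 addr0 qfZ => h; apply: (le_trans h).
rewrite lerD2l.
have := ler_qf_nrm H x; rewrite ler_norml -/k => /andP[_ h1].
have := ler_wpM2l (ltW t0) h1 => /le_trans; apply.
rewrite /t mulrAC ler_pdivrMr; last by lra.
by nra.
Qed.

End ExtendedGramian.

(** * Locally absolutely continuous functions *)

Section Primitive.
Variable R : realType.
Notation mu := (@lebesgue_measure R).
Implicit Types (F G f g : R -> R).

(* [F] is locally absolutely continuous on [0, +oo[ with derivative [f]. *)
Definition primitive F f := forall T, 0 <= T ->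
  mu.-integrable `[0, T] (EFin \o f) /\
  F T = F 0 + \int[mu]_(s in `[0, T]) f s.

Definition loc_int f := forall T, 0 <= T -> mu.-integrable `[0, T] (EFin \o f).

Lemma primitive_int F f : primitive F f -> loc_int f.
Proof. by move=> pF T /pF[]. Qed.

Lemma loc_int_oc f s t : loc_int f -> 0 <= s -> s <= t ->
  mu.-integrable `]s, t] (EFin \o f).
Proof.
move=> If s0 st; apply: integrableS (If t (le_trans s0 st)) => //.
move=> z /=; rewrite !in_itv/= => /andP[sz ->]; rewrite andbT.
by rewrite (le_trans s0)// ltW.
Qed.

Lemma primitive_incr F f s t : primitive F f -> 0 <= s -> s <= t ->
  F t - F s = \int[mu]_(z in `]s, t]) f z.
Proof.
move=> pF s0 st; have t0 := le_trans s0 st.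
have [It ->] := pF t t0; have [_ ->] := pF s s0.
by rewrite opprD addrACA subrr add0r Rintegral_itvB.
Qed.

Lemma primitive_cst c : primitive (fun=> c) (fun=> 0).
Proof.
move=> T T0; split; last by rewrite Rintegral_cst// mul0r addr0.
by apply: (eq_integrable _ (cst 0%E)) => //; exact: integrable0.
Qed.

Lemma loc_intD f g : loc_int f -> loc_int g -> loc_int (fun s => f s + g s).
Proof.
move=> If Ig T T0; rewrite (_ : _ \o _ = (EFin \o f) \+ (EFin \o g))%E//.
by apply: integrableD => //; [exact: If|exact: Ig].
Qed.

Lemma loc_intZ a f : loc_int f -> loc_int (fun s => a * f s).
Proof.
move=> If T T0; rewrite (_ : _ \o _ = (fun x => a%:E * (EFin \o f) x))%E//.
by apply: integrableZl => //; exact: If.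
Qed.

Lemma primitiveD F f G g : primitive F f -> primitive G g ->
  primitive (fun s => F s + G s) (fun s => f s + g s).
Proof.
move=> pF pG T T0; split; first exact: (loc_intD (primitive_int pF) (primitive_int pG)).
have [If ->] := pF T T0; have [Ig ->] := pG T T0.
by rewrite RintegralD// addrACA.
Qed.

Lemma primitiveZ a F f : primitive F f ->
  primitive (fun s => a * F s) (fun s => a * f s).
Proof.
move=> pF T T0; split; first exact: (loc_intZ a (primitive_int pF)).
by have [If ->] := pF T T0; rewrite RintegralZl// mulrDr.
Qed.

Lemma eq_primitive F f G g : (forall s, 0 <= s -> F s = G s) ->
  (forall s, 0 <= s -> f s = g s) -> primitive F f -> primitive G g.
Proof.
move=> FG fg pF T T0; have [If e] := pF T T0; split.
  apply: eq_integrable If => // s; rewrite inE/= in_itv/= => /andP[s0 _].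
  by rewrite fg.
rewrite -!FG// e; congr (_ + _); apply: eq_Rintegral => s.
by rewrite inE/= in_itv/= => /andP[s0 _]; rewrite fg.
Qed.

Lemma primitive_sum n (F f : 'I_n -> R -> R) : (forall i, primitive (F i) (f i)) ->
  primitive (fun s => \sum_i F i s) (fun s => \sum_i f i s).
Proof.
elim: n F f => [|n IH] F f pF.
  by apply: eq_primitive (primitive_cst 0) => s _; rewrite big_ord0.
apply: eq_primitive (primitiveD (pF ord0) (IH _ _ (fun i => pF (lift ord0 i)))) => s _;
  by rewrite big_ord_recl.
Qed.

Lemma loc_int_primitive f : loc_int f ->
  primitive (fun t => \int[mu]_(s in `[0, t]) f s) f.
Proof.
move=> If T T0; split; first exact: If.
by rewrite set_itv1 Rintegral_set1 add0r.
Qed.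

Lemma loc_int_norm f : loc_int f -> loc_int (fun s => `|f s|).
Proof. by move=> If T T0; exact: (integrable_norm (If T T0)). Qed.

Lemma primitive_continuous F f T : primitive F f -> 0 <= T ->
  {within `[0, T], continuous F}.
Proof.
move=> pF T0; have [If _] := pF T T0.
have cI := parameterized_integral_continuous T0 If.
have cF : {within `[0, T], continuous (cst (F 0) \+
    (fun x => parameterized_integral mu 0 x f))}.
  by move=> z; apply: cvgD; [exact: cvg_cst|exact: cI].
apply: subspace_eq_continuous cF => z; rewrite inE/= in_itv/= => /andP[z0 _].
by have [_ /esym e] := pF z z0; exact: e.
Qed.

Lemma primitive_norm_incr F f s t : primitive F f -> 0 <= s -> s <= t ->
  `|F t - F s| <= \int[mu]_(z in `]s, t]) `|f z|.
Proof.
move=> pF s0 st; rewrite (primitive_incr pF)//.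
by apply: le_normr_Rintegral => //; apply: loc_int_oc => //; exact: primitive_int pF.
Qed.

(* Halving [A] between [s] and [t] by the intermediate value theorem halves the
   quadratic bound. *)
Lemma eq_of_quadratic_increments (Psi A : R -> R) (C T : R) : 0 <= T ->
  {within `[0, T], continuous A} ->
  (forall s t, 0 <= s -> s <= t -> t <= T -> A s <= A t) ->
  (forall s t, 0 <= s -> s <= t -> t <= T ->
    `|Psi t - Psi s| <= C * (A t - A s) ^+ 2) ->
  Psi T = Psi 0.
Proof.
move=> T0 cA mA hPsi.
have bis k s t : 0 <= s -> s <= t -> t <= T ->
    `|Psi t - Psi s| <= C * (A t - A s) ^+ 2 / 2 ^+ k.
  elim: k s t => [|k IH] s t s0 st tT; first by rewrite expr0 divr1 hPsi.
  have cst_ : {within `[s, t], continuous A}.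
    apply: continuous_subspaceW cA => z /=; rewrite !in_itv/= => /andP[sz zt].
    by rewrite (le_trans s0 sz) (le_trans zt tT).
  have [|r] := IVT (v := (A s + A t) / 2) st cst_.
    have := mA s t s0 st tT => Ast.
    by rewrite min_l// max_r//; apply/andP; split; lra.
  rewrite in_itv/= => /andP[sr rt] Ar.
  have h1 := IH s r s0 sr (le_trans rt tT).
  have h2 := IH r t (le_trans s0 sr) rt tT.
  have -> : Psi t - Psi s = (Psi t - Psi r) + (Psi r - Psi s) by ring.
  apply: (le_trans (ler_normD _ _)); apply: (le_trans (lerD h2 h1)).
  rewrite Ar [2 ^+ k.+1]exprS le_eqVlt; apply/orP; left; apply/eqP.
  have : 2 ^+ k != 0 :> R by rewrite expf_neq0.
  by move: (2 ^+ k) (A s) (A t) => p a a' p0; field.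
apply/eqP; rewrite -subr_eq0 -normr_le0; apply/ler_addgt0Pr => e e0; rewrite add0r.
set B := C * (A T - A 0) ^+ 2.
have [k hk] : exists k, `|B| / e < 2 ^+ k.
  have [k hk] : exists k : nat, `|B| / e < k%:R.
    by exists (Num.bound (`|B| / e)); apply: archi_boundP; rewrite divr_ge0// ltW.
  exists k; apply: (lt_trans hk); rewrite -natrX ltr_nat; exact: ltn_expl.
apply: (le_trans (bis k 0 T (lexx 0) T0 (lexx T))); rewrite -/B.
rewrite ler_pdivrMr ?exprn_gt0// (le_trans (ler_norm B))//.
by rewrite mulrC -ler_pdivrMr// ltW.
Qed.

End Primitive.

(** * Chain and product rules for absolutely continuous functions *)

Section PrimitiveCalculus.
Variable R : realType.
Notation mu := (@lebesgue_measure R).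
Implicit Types (F G f g h phi dphi : R -> R).

Lemma within_continuous_bounded f (a b : R) : {within `[a, b], continuous f} ->
  exists2 M, 0 <= M & forall s, a <= s -> s <= b -> `|f s| <= M.
Proof.
move=> cf; case: (leP a b) => [ab|ba]; last first.
  by exists 0 => // s a1 b1; move: (le_trans a1 b1); rewrite leNgt ba.
have [c1 _ h1] := EVT_max ab cf; have [c2 _ h2] := EVT_min ab cf.
exists (`|f c1| + `|f c2|); first by rewrite addr_ge0.
move=> s sa sb; have sab : s \in `[a, b]%R by rewrite in_itv/= sa sb.
have := h1 s sab; have := h2 s sab.
have := ler_norm (f c1); have := ler_norm (- f c2); rewrite normrN.
have := normr_ge0 (f c1); have := normr_ge0 (f c2).
by rewrite ler_norml => *; apply/andP; split; lra.
Qed.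

Lemma loc_intM h f : (forall T, 0 <= T -> {within `[0, T], continuous h}) ->
  loc_int f -> loc_int (fun s => h s * f s).
Proof.
move=> ch If T T0.
rewrite (_ : _ \o _ = (EFin \o h) \* (EFin \o f))%E//.
apply: integrableMr => //; last exact: If.
  by apply: subspace_continuous_measurable_fun => //; exact: ch.
have [M M0 hM] := within_continuous_bounded (ch T T0).
exists M; split; first exact: num_real.
move=> x Mx s /=; rewrite in_itv/= => /andP[s0 sT].
exact: le_trans (hM s s0 sT) (ltW Mx).
Qed.

Lemma mean_value phi dphi (a b : R) : (forall x, is_derive x (1 : R) phi (dphi x)) ->
  exists c, [/\ `|c - a| <= `|b - a|, `|c| <= Num.max `|a| `|b| &
    phi b - phi a = dphi c * (b - a)].
Proof.
move=> dp.
have cp : continuous phi.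
  by move=> x; apply/differentiable_continuous/derivable1_diffP; case: (dp x).
have cw x y : {within `[x, y], continuous phi} by apply: continuous_subspaceT.
case: (ltgtP a b) => [ab|ba|->]; last first.
- by exists b; split; rewrite ?subrr ?mulr0// le_max lexx.
- have [c] := MVT ba (fun x _ => dp x) (cw b a).
  rewrite in_itv/= => /andP[bc ca] e; exists c; split.
  + by rewrite !ltr0_norm ?subr_lt0//; lra.
  + rewrite le_max; case: (lerP 0 c) => c0; apply/orP; [left|right].
      by rewrite ger0_norm// (le_trans (ltW ca))// ler_norm.
    by rewrite ltr0_norm// -[`|b|]normrN (le_trans _ (ler_norm _))// lerN2 ltW.
  by rewrite -opprB e; ring.
have [c] := MVT ab (fun x _ => dp x) (cw a b).
rewrite in_itv/= => /andP[ac cb] e; exists c; split => //.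
- by rewrite !gtr0_norm ?subr_gt0//; lra.
rewrite le_max; case: (lerP 0 c) => c0; apply/orP; [right|left].
  by rewrite ger0_norm// (le_trans (ltW cb))// ler_norm.
by rewrite ltr0_norm// -[`|a|]normrN (le_trans _ (ler_norm _))// lerN2 ltW.
Qed.

(** No pointwise derivative of [F] is taken. With [I] the integral of [dphi (F s) * f s] and [A]
    that of the absolute value of [f], the increments of [phi (F t) - I t] are quadratic in those of
    [A], which forces this difference to be constant. *)
Lemma primitive_comp phi dphi F f : (forall x, is_derive x (1 : R) phi (dphi x)) ->
  continuous dphi ->
  (forall M : R, exists K : R, forall a b : R, `|a| <= M -> `|b| <= M ->
    `|dphi b - dphi a| <= K * `|b - a|) ->
  primitive F f -> primitive (fun s => phi (F s)) (fun s => dphi (F s) * f s).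
Proof.
move=> dp cdp lip pF.
have Idf : loc_int (fun s => dphi (F s) * f s).
  apply: loc_intM (primitive_int pF) => T T0 z.
  by apply: continuous_comp; [exact: (primitive_continuous pF T0)|exact: cdp].
have pI := loc_int_primitive Idf.
have pA := loc_int_primitive (loc_int_norm (primitive_int pF)).
set A := (X in primitive X (fun s => `|f s|)) in pA.
set I := (X in primitive X (fun s => dphi (F s) * f s)) in pI.
move=> T T0; split; first exact: Idf.
have [M M0 hM] := within_continuous_bounded (primitive_continuous pF T0).
have [K hK] := lip M.
have K0 := normr_ge0 K.
have {}hK a b : `|a| <= M -> `|b| <= M -> `|dphi b - dphi a| <= `|K| * `|b - a|.
  by move=> aM bM; apply: (le_trans (hK a b aM bM)); rewrite ler_wpM2r// ler_norm.
have Aincr s t : 0 <= s -> s <= t -> A t - A s = \int[mu]_(z in `]s, t]) `|f z|.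
  by move=> s0 st; exact: primitive_incr pA s0 st.
suff : phi (F T) - I T = phi (F 0) - I 0.
  by rewrite /I set_itv1 Rintegral_set1 subr0 => <-; rewrite subrK.
(* Both [phi (F t) - phi (F s)] and [I t - I s] are compared with the linearization
   [dphi (F s) * (F t - F s)]; each comparison costs one Lipschitz constant, hence the factor 2. *)
apply: (eq_of_quadratic_increments (Psi := fun t => phi (F t) - I t) (A := A)
  (C := 2 * `|K|) T0).
- exact: primitive_continuous pA T0.
- move=> s t s0 st _; rewrite -subr_ge0 Aincr//.
  by apply: Rintegral_ge0 => z _; exact: normr_ge0.
move=> s t s0 st tT.
have FA z : s <= z -> z <= t -> `|F z - F s| <= A t - A s.
  move=> sz zt; apply: (le_trans (primitive_norm_incr pF s0 sz)).
  rewrite -Aincr// lerD2r -subr_ge0 Aincr//; last exact: le_trans s0 sz.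
  by apply: Rintegral_ge0 => *; exact: normr_ge0.
have FM z : s <= z -> z <= t -> `|F z| <= M.
  by move=> sz zt; apply: hM; [exact: le_trans s0 sz|exact: le_trans zt tT].
have Ifst := loc_int_oc (primitive_int pF) s0 st.
have e1 : `|phi (F t) - phi (F s) - dphi (F s) * (F t - F s)| <=
    `|K| * (A t - A s) ^+ 2.
  have [c [ca cM ->]] := mean_value (F s) (F t) dp.
  rewrite -mulrBl normrM expr2 mulrA ler_pM//; last exact: FA.
  have cM' : `|c| <= M by rewrite (le_trans cM)// ge_max !FM.
  apply: (le_trans (hK _ _ (FM s (lexx s) st) cM')).
  by rewrite ler_wpM2l// (le_trans ca)// FA.
have e2 : `|I t - I s - dphi (F s) * (F t - F s)| <= `|K| * (A t - A s) ^+ 2.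
  have Idst := loc_int_oc Idf s0 st.
  rewrite (primitive_incr pI)// (primitive_incr pF)// -RintegralZl//.
  have Idfs : mu.-integrable `]s, t] (EFin \o (fun z => dphi (F s) * f z)).
    exact: loc_int_oc (loc_intZ _ (primitive_int pF)) s0 st.
  have Idd : mu.-integrable `]s, t] (EFin \o (fun z => dphi (F z) * f z - dphi (F s) * f z)).
    pose g1 z := dphi (F z) * f z; pose g2 z := dphi (F s) * f z.
    rewrite (_ : _ \o _ = (EFin \o g1) \- (EFin \o g2))%E//.
    exact: integrableB.
  rewrite -RintegralB//; apply: (le_trans (le_normr_Rintegral _ Idd)) => //.
  rewrite expr2 mulrA {2}Aincr// -RintegralZl//; last first.
    exact: loc_int_oc (loc_int_norm (primitive_int pF)) s0 st.
  apply: le_Rintegral => //.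
  - exact: (integrable_norm Idd).
  - exact: loc_int_oc (loc_intZ _ (loc_int_norm (primitive_int pF))) s0 st.
  move=> z /=; rewrite in_itv/= => /andP[sz zt].
  rewrite -mulrBl normrM ler_wpM2r//.
  apply: (le_trans (hK _ _ (FM s (lexx s) st) (FM z (ltW sz) zt))).
  by rewrite ler_wpM2l// FA// ltW.
have -> : phi (F t) - I t - (phi (F s) - I s) =
    (phi (F t) - phi (F s) - dphi (F s) * (F t - F s)) -
    (I t - I s - dphi (F s) * (F t - F s)) by ring.
by apply: (le_trans (ler_normB _ _)); lra.
Qed.

Lemma primitive_sqr F f : primitive F f ->
  primitive (fun s => F s ^+ 2) (fun s => 2 * F s * f s).
Proof.
apply: (@primitive_comp (fun x => x ^+ 2) (fun x => 2 * x)).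
- move=> x; apply: is_derive_eq.
  by rewrite /GRing.scale/= mulr1 mulr_natl mulr2n.
- by move=> x; apply: cvgM; [exact: cvg_cst|exact: cvg_id].
by move=> M; exists 2 => a b _ _; rewrite -mulrBr normrM ger0_norm.
Qed.

(** By polarization, the one-variable chain rule for squares suffices. *)
Lemma primitiveM F f G g : primitive F f -> primitive G g ->
  primitive (fun s => F s * G s) (fun s => f s * G s + F s * g s).
Proof.
move=> pF pG.
have h1 := primitiveZ 4^-1 (primitive_sqr (primitiveD pF pG)).
have h2 := primitiveZ (- 4^-1) (primitive_sqr (primitiveD pF (primitiveZ (- 1) pG))).
by apply: eq_primitive (primitiveD h1 h2) => s _ /=; field.
Qed.

Lemma primitive_expR F f : primitive F f ->
  primitive (fun s => expR (F s)) (fun s => expR (F s) * f s).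
Proof.
apply: primitive_comp => [|M].
  exact: continuous_expR.
exists (expR M) => a b aM bM.
have [c [_ cM ->]] := mean_value a b (fun x => is_derive_expR x).
rewrite normrM ler_wpM2r// ger0_norm ?expR_ge0// ler_expR.
by rewrite (le_trans (ler_norm _))// (le_trans cM)// ge_max aM bM.
Qed.

Lemma primitive_of_derive F f : {within `[0, +oo[, continuous F} ->
  {within `[0, +oo[, continuous f} ->
  (forall t : R, 0 < t -> is_derive t (1 : R) F (f t)) -> primitive F f.
Proof.
move=> cF cf dF T T0.
have sub : (`[0, T] : set R) `<=` `[0, +oo[.
  by move=> z /=; rewrite !in_itv/= => /andP[->].
have {}cF := continuous_subspaceW sub cF; have {}cf := continuous_subspaceW sub cf.
split; first by apply: continuous_compact_integrable => //; exact: segment_compact.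
move: T0; rewrite le_eqVlt => /predU1P[<-|T0].
  by rewrite set_itv1 Rintegral_set1 addr0.
rewrite /Rintegral (continuous_FTC2 T0 cf (F := F)).
- by rewrite -EFinB [fine _]/= addrC subrK.
- have [_ h1 h2] := (continuous_within_itvP _ T0).1 cF.
  split => // z; rewrite in_itv/= => /andP[z0 _].
  by case: (dF z z0).
move=> z; rewrite in_itv/= => /andP[z0 _].
by have := dF z z0; rewrite derive1E => h; rewrite derive_val.
Qed.

End PrimitiveCalculus.

(** * The Lyapunov flow *)

Section MatrixPrimitive.
Variable R : realType.
Notation mu := (@lebesgue_measure R).

Lemma cvg_sum_ord T (F : set_system T) (FF : Filter F) n (f : 'I_n -> T -> R) l :
  (forall i, f i x @[x --> F] --> l i) ->
  (\sum_i f i x) @[x --> F] --> (\sum_i l i : R).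
Proof.
elim: n f l => [|n IH] f l fl.
  rewrite big_ord0 (_ : (fun x => _) = cst 0); first exact: cvg_cst.
  by apply/funext => x; rewrite big_ord0.
rewrite big_ord_recl (_ : (fun x => _) =
  (fun x => f ord0 x + \sum_i f (lift ord0 i) x)); last first.
  by apply/funext => x; rewrite big_ord_recl.
by apply: cvgD => //; apply: IH.
Qed.

Lemma linear_entries m n p q (L : 'M[R]_(m, n) -> 'M[R]_(p, q)) W i j : linear L ->
  L W i j = \sum_k \sum_l L (delta_mx k l) i j * W k l.
Proof.
move=> lL.
pose F : {linear 'M[R]_(m, n) -> 'M[R]_(p, q)} :=
  HB.pack L (GRing.isLinear.Build _ _ _ _ L lL).
rewrite -[L W]/(F W) {1}[W]matrix_sum_delta linear_sum summxE.
apply: eq_bigr => k _; rewrite linear_sum summxE; apply: eq_bigr => l _.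
by rewrite linearZ mxE mulrC.
Qed.

Lemma linear_nrm_bound m n p q (L : 'M[R]_(m, n) -> 'M[R]_(p, q)) : linear L ->
  exists2 b, 0 <= b & forall W, nrm (L W) <= b * nrm W.
Proof.
move=> lL; exists (\sum_i \sum_j \sum_k \sum_l `|L (delta_mx k l) i j|).
  by do 4! (apply: sumr_ge0 => ? _).
move=> W; rewrite {1}/nrm mulr_suml; apply: ler_sum => i _.
rewrite mulr_suml; apply: ler_sum => j _; rewrite (linear_entries _ _ _ lL).
rewrite (le_trans (ler_norm_sum _ _ _))// mulr_suml; apply: ler_sum => k _.
rewrite (le_trans (ler_norm_sum _ _ _))// mulr_suml; apply: ler_sum => l _.
by rewrite normrM ler_wpM2l// ler_nrm.
Qed.

Definition mx_primitive m n (F f : R -> 'M[R]_(m, n)) :=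
  forall i j, primitive (fun t => F t i j) (fun t => f t i j).

Lemma mx_primitive_linear m n p q (L : 'M[R]_(m, n) -> 'M[R]_(p, q)) F f :
  linear L -> mx_primitive F f -> mx_primitive (fun t => L (F t)) (fun t => L (f t)).
Proof.
move=> lL pF i j.
have h := primitive_sum (fun k => primitive_sum (fun l =>
  primitiveZ (L (delta_mx k l) i j) (pF k l))).
by apply: eq_primitive h => t _; rewrite [RHS](linear_entries _ _ _ lL).
Qed.

Lemma qf_primitive n (F f : R -> 'M[R]_n) x : mx_primitive F f ->
  primitive (fun t => qf (F t) x) (fun t => qf (f t) x).
Proof.
move=> pF.
have lq : linear (fun M : 'M[R]_n => (qf M x)%:M : 'M[R]_1).
  by move=> a U W; rewrite qfD qfZ scale_scalar_mx raddfD.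
have h := mx_primitive_linear lq pF 0 0.
by apply: eq_primitive h => t _; rewrite mxE.
Qed.

Lemma mx_integral_primitive n (F : R -> 'M[R]_n) :
  (forall i j, loc_int (fun t => F t i j)) -> mx_primitive (mx_integral_to F) F.
Proof.
by move=> If i j; apply: eq_primitive (loc_int_primitive (If i j)) => t _; rewrite ?mxE.
Qed.

Lemma mx_integral_to0 n (F : R -> 'M[R]_n) : mx_integral_to F 0 = 0.
Proof. by apply/matrixP => i j; rewrite !mxE set_itv1 Rintegral_set1. Qed.

Lemma primitive_unique (F G f : R -> R) (T : R) : primitive F f -> primitive G f -> 0 <= T ->
  F T - F 0 = G T - G 0.
Proof.
by move=> pF pG T0; have [_ ->] := pF T T0; have [_ ->] := pG T T0; lra.
Qed.

Lemma primitive_linear_fun (a : R) : primitive (fun t => a * t) (fun=> a).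
Proof.
move=> T T0; split.
  by apply: continuous_compact_integrable; [exact: segment_compact|apply: continuous_subspaceT => ?; exact: cvg_cst].
rewrite mulr0 add0r Rintegral_cst//= lebesgue_measure_itv /= lte_fin.
move: T0; rewrite le_eqVlt => /predU1P[<-|T0]; first by rewrite ltxx.
by rewrite T0 /= subr0.
Qed.

Lemma primitive_lip (F f : R -> R) (k s t : R) : primitive F f -> 0 <= s -> s <= t ->
  (forall z, s <= z -> z <= t -> `|f z| <= k) -> `|F t - F s| <= k * (t - s).
Proof.
move=> pF s0 st fk; apply: (le_trans (primitive_norm_incr pF s0 st)).
have pk := primitive_linear_fun k.
rewrite mulrBr (primitive_incr pk)//; apply: le_Rintegral => //.
- exact: loc_int_oc (loc_int_norm (primitive_int pF)) s0 st.
- exact: loc_int_oc (primitive_int pk) s0 st.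
by move=> z /=; rewrite in_itv/= => /andP[sz zt]; rewrite fk// ltW.
Qed.

Lemma primitive_le (F f : R -> R) (s t : R) : primitive F f -> 0 <= s -> s <= t ->
  (forall z, s <= z -> z <= t -> 0 <= f z) -> F s <= F t.
Proof.
move=> pF s0 st f0; rewrite -subr_ge0 (primitive_incr pF)//.
by apply: Rintegral_ge0 => z /=; rewrite in_itv/= => /andP[sz zt]; rewrite f0// ltW.
Qed.

Lemma exp_damped_primitive (e : R) (F f : R -> R) : primitive F f ->
  primitive (fun t => expR (- e * t) * F t) (fun t => expR (- e * t) * (f t - e * F t)).
Proof.
move=> pF; have h := primitiveM (primitive_expR (primitive_linear_fun (- e))) pF.
by apply: eq_primitive h => t _ //=; ring.
Qed.

End MatrixPrimitive.

(** * Positivity of the Lyapunov flow *)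

Section LyapunovFlow.
Variables (R : realType) (n m : nat) (gamma : R).
Variables (B : 'M[R]_n) (K : 'I_m -> 'M[R]_n) (Z0 : 'M[R]_n) (Z : R -> 'M[R]_n).
Notation mu := (@lebesgue_measure R).
Notation gl := (gen_lyapunov gamma B K).
Hypothesis odeZ : matrix_ode_solution gl Z0 Z.

Lemma ode_entry_continuous i j : {within `[0, +oo[, continuous (fun t => Z t i j)}.
Proof.
have [_ cZ _] := odeZ => t.
have := @continuous_comp (subspace (`[0, +oo[ : set R)) 'M[R]_n R Z (fun M => M i j) t.
by apply; [exact: cZ|exact: coord_continuous].
Qed.

Lemma ode_primitive : mx_primitive Z (fun t => gl (Z t)).
Proof.
move=> i j; apply: primitive_of_derive; first exact: ode_entry_continuous.
  have h : {within `[0, +oo[, continuous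
      (fun t => \sum_k \sum_l gl (delta_mx k l) i j * Z t k l)}.
    move=> t; apply: cvg_sum_ord => k; apply: cvg_sum_ord => l.
    by apply: cvgM; [exact: cvg_cst|exact: ode_entry_continuous].
  apply: subspace_eq_continuous h => t _ /=.
  by rewrite [RHS](linear_entries _ _ _ (gen_lyapunov_linear gamma B K)).
by move=> t t0; have [_ _] := odeZ; apply.
Qed.

(** Damping the flow by [expR (- 2 e t)] amounts to shifting [B] by [- e], so the damped flow is a
    primitive of its own image and the operator commutes with the integral. *)
Lemma ode_damped_integral e T : 0 <= T ->
  gen_lyapunov gamma (B - e%:M) K (mx_integral_to (fun t => expR (- (2 * e) * t) *: Z t) T)
  = expR (- (2 * e) * T) *: Z T - Z0.
Proof.
move=> T0; pose F t := expR (- (2 * e) * t) *: Z t.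
have pF : mx_primitive F (fun t => gen_lyapunov gamma (B - e%:M) K (F t)).
  move=> i j; apply: eq_primitive (exp_damped_primitive (2 * e) (ode_primitive i j)) => t _.
    by rewrite mxE.
  by rewrite gen_lyapunov_shift gen_lyapunovZ !mxE; ring.
have IF i j : loc_int (fun t => F t i j).
  move=> S S0; apply: continuous_compact_integrable; first exact: segment_compact.
  exact: primitive_continuous (pF i j) S0.
have pI := mx_primitive_linear (gen_lyapunov_linear gamma (B - e%:M) K) (mx_integral_primitive IF).
apply/matrixP => i j; have := primitive_unique (pI i j) (pF i j) T0.
rewrite /F mx_integral_to0 gen_lyapunov0 !mxE subr0 mulr0 expR0 mul1r.
by have [-> _ _] := odeZ.
Qed.

Lemma ode_integral T : 0 <= T -> gl (mx_integral_to Z T) = Z T - Z0.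
Proof.
move=> T0; have := ode_damped_integral 0 T0.
rewrite mulr0 oppr0 mul0r expR0 scale1r raddf0 subr0 => <-.
congr (gl (mx_integral_to _ T)); apply/funext => t.
by rewrite mul0r expR0 scale1r.
Qed.

Lemma ode_bounded T : exists2 C, 0 <= C & forall t, 0 <= t -> t <= T -> nrm (Z t) <= C.
Proof.
have h i j : exists M, 0 <= M /\ forall s, 0 <= s -> s <= T -> `|Z s i j| <= M.
  have sub : (`[0, T] : set R) `<=` `[0, +oo[.
    by move=> z /=; rewrite !in_itv/= => /andP[->].
  have [M M0 hM] := within_continuous_bounded
    (continuous_subspaceW sub (ode_entry_continuous (i := i) (j := j))).
  by exists M.
have /choice[Mf hMf] : forall ij : 'I_n * 'I_n, exists M, 0 <= M /\
    forall s, 0 <= s -> s <= T -> `|Z s ij.1 ij.2| <= M by move=> [i j]; exact: h.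
exists (\sum_i \sum_j Mf (i, j)).
  by apply: sumr_ge0 => i _; apply: sumr_ge0 => j _; case: (hMf (i, j)).
move=> t t0 tT; apply: ler_sum => i _; apply: ler_sum => j _.
by case: (hMf (i, j)) => _; apply.
Qed.

Lemma nrm_entries (W : 'M[R]_n) (c : R) : (forall i j, `|W i j| <= c) ->
  nrm W <= (n * n)%:R * c.
Proof.
move=> h; apply: (@le_trans _ _ (\sum_(i < n) \sum_(j < n) c)).
  by apply: ler_sum => i _; apply: ler_sum => j _.
by rewrite !sumr_const !card_ord -mulrnA mulr_natl.
Qed.

Lemma ode_taylor T : exists2 C, 0 <= C & forall s t, 0 <= s -> s <= t -> t <= T ->
  nrm (Z t - Z s - (t - s) *: gl (Z s)) <= C * (t - s) ^+ 2.
Proof.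
have [C C0 hC] := ode_bounded T.
have [L L0 hL] := linear_nrm_bound (gen_lyapunov_linear gamma B K).
pose N2 : R := (n * n)%:R; have N20 : 0 <= N2 by exact: ler0n.
have incr s t : 0 <= s -> s <= t -> t <= T -> nrm (Z t - Z s) <= N2 * (L * C * (t - s)).
  move=> s0 st tT; apply: nrm_entries => i j; rewrite !mxE.
  apply: (primitive_lip (ode_primitive i j) s0 st) => z sz zt.
  apply: (le_trans (ler_nrm _ _ _)); apply: (le_trans (hL _)).
  by rewrite ler_wpM2l// hC// ?(le_trans s0)// (le_trans zt).
(* A Lipschitz bound [N2 L C] for [Z] turns into one for its derivative by another factor [L]; each
   factor [N2] passes from entries to [nrm]. *)
exists (N2 * (L * (N2 * (L * C)))); first by rewrite !mulr_ge0.
move=> s t s0 st tT; rewrite -mulrA; apply: nrm_entries => i j.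
have pl := primitiveD (ode_primitive i j) (primitive_linear_fun (- gl (Z s) i j)).
have -> : (Z t - Z s - (t - s) *: gl (Z s)) i j =
    (Z t i j + - gl (Z s) i j * t) - (Z s i j + - gl (Z s) i j * s).
  by move: (gl (Z s)) => G; rewrite !mxE; ring.
rewrite expr2 mulrA; apply: (primitive_lip pl s0 st) => z sz zt.
have -> : gl (Z z) i j - gl (Z s) i j = gl (Z z - Z s) i j.
  by rewrite gen_lyapunovB; move: (gl (Z z)) (gl (Z s)) => G1 G2; rewrite !mxE.
apply: (le_trans (ler_nrm _ _ _)); apply: (le_trans (hL _)).
rewrite -mulrA ler_wpM2l//; apply: (le_trans (incr s z s0 sz (le_trans zt tT))).
by rewrite -[leRHS]mulrA ler_wpM2l// ler_wpM2l ?mulr_ge0// lerD2r.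
Qed.

(** Explicit Euler argument: along a grid of step [h], the perturbed matrix [Z s + e expR (k s) I]
    stays in the cone. The growth of the perturbation dominates the second-order defects of the
    scheme and of the Taylor expansion. *)
Lemma ode_psd : psd Z0 -> forall T, 0 <= T -> psd (Z T).
Proof.
move=> Z0p T T0 x; apply/ler_addgt0Pr => e0 e00.
set q := qf 1%:M x; have q0 : 0 <= q by exact: qf1_ge0.
have [C C0 hC] := ode_bounded T.
have [C2 C20 hT] := ode_taylor T.
have lBB : linear (fun D : 'M[R]_n => B *m D *m B^T).
  by move=> a U W; rewrite mulmxDr mulmxDl -scalemxAr -scalemxAl.
have [L L0 hL] := linear_nrm_bound lBB.
(* The norm compensates the action of the operator on the perturbation; the [+ 1] leaves a surplus
   [a h] at each step, [a] being the current size of the perturbation. *)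
pose k := nrm (gl 1%:M) + 1; have k0 : 0 <= k by rewrite addr_ge0 ?nrm_ge0.
pose e := e0 / (expR (k * T) * (q + 1)).
have e1 : 0 < e by rewrite divr_gt0// mulr_gt0 ?expR_gt0//; lra.
pose a1 := e * expR (k * T); have a10 : 0 <= a1 by rewrite mulr_ge0 ?expR_ge0// ltW.
pose K1 := L * (C + a1 * nrm (1%:M : 'M[R]_n)).
have K10 : 0 <= K1 by rewrite mulr_ge0// addr_ge0// mulr_ge0// nrm_ge0.
(* With this many steps [h (K1 + C2) <= e <= a], so the surplus [a h] covers the errors
   [h^2 (K1 + C2)]. *)
have [N hN] : exists N : nat, T * (K1 + C2) / e < N.+1%:R.
  exists (Num.bound (T * (K1 + C2) / e)).
  apply: (@lt_trans _ _ (Num.bound (T * (K1 + C2) / e))%:R); last by rewrite ltr_nat.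
  by apply: archi_boundP; exact: divr_ge0 (mulr_ge0 T0 (addr_ge0 K10 C20)) (ltW e1).
pose h := T / N.+1%:R; have h0 : 0 <= h by rewrite divr_ge0.
have hh : h * (K1 + C2) <= e.
  by rewrite /h mulrAC ler_pdivrMr ?ltr0n// [leRHS]mulrC -ler_pdivrMr// ltW.
have NT : N.+1%:R * h = T by rewrite mulrC /h divfK// pnatr_eq0.
clearbody h.
suff hk k' : (k' <= N.+1)%N -> psd (Z (k'%:R * h) + (e * expR (k * (k'%:R * h))) *: 1%:M).
  have := hk _ (leqnn _) x; rewrite NT qfD qfZ -/q => /le_trans; apply.
  rewrite lerD2l /e; have E0 := expR_gt0 (k * T).
  have -> : e0 / (expR (k * T) * (q + 1)) * expR (k * T) * q = e0 * q / (q + 1).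
    by field; apply/andP; split; apply/eqP; lra.
  by rewrite ler_pdivrMr; nra.
elim: k' => [_ y|k' IH k'N y].
  rewrite mul0r mulr0 expR0 mulr1 qfD qfZ.
  have [-> _ _] := odeZ; have := mulr_ge0 (ltW e1) (qf1_ge0 y).
  by have := Z0p y; lra.
set s := k'%:R * h; have s0 : 0 <= s by rewrite mulr_ge0.
have et : k'.+1%:R * h = s + h by rewrite -natr1 mulrDl mul1r.
rewrite et; set a := e * expR (k * s).
have sT : s + h <= T by rewrite -et -NT ler_wpM2r// ler_nat.
have D0 : psd (Z s + a *: 1%:M) by apply: IH; exact: ltnW.
have ae : e <= a.
  rewrite -[leLHS]mulr1; apply: ler_wpM2l (ltW e1) _ _ _.
  by rewrite -expR0 ler_expR mulr_ge0.
have aa1 : a <= a1.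
  by apply: ler_wpM2l (ltW e1) _ _ _; rewrite ler_expR ler_wpM2l//; lra.
have := euler_ge gamma B K y h0 D0; rewrite qf_gen_lyapunovDZ qfD qfZ => E1.
set Q := qf 1%:M y in E1 *; have Q0 : 0 <= Q by exact: qf1_ge0.
have b1 : nrm (B *m (Z s + a *: 1%:M) *m B^T) <= K1.
  apply: (le_trans (hL _)); rewrite ler_wpM2l// (le_trans (nrmD _ _))// lerD//.
    by rewrite hC//; lra.
  rewrite nrmZ ger0_norm ?ler_wpM2r ?nrm_ge0//.
  by apply: le_trans ae; exact: ltW.
have b2 := ler_qf_nrm (gl 1%:M) y; rewrite -/Q ler_norml in b2.
have b3 := ler_qf_nrm (Z (s + h) - Z s - (s + h - s) *: gl (Z s)) y.
rewrite -/Q ler_norml in b3; move: b3 => /andP[b3 _]; move: b2 => /andP[_ b2].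
have ssh : s <= s + h by rewrite lerDl.
have b4 := hT s (s + h) s0 ssh sT.
have shs : s + h - s = h by ring.
rewrite shs in b3 b4.
have eq3 : qf (Z (s + h) - Z s - h *: gl (Z s)) y =
    qf (Z (s + h)) y - qf (Z s) y - h * qf (gl (Z s)) y.
  by move: (gl (Z s)) => G; rewrite !qfB qfZ.
rewrite eq3 in b3.
have b5 : a * (1 + k * h) <= e * expR (k * (s + h)).
  have -> : k * (s + h) = k * s + k * h by ring.
  rewrite expRD mulrA -/a ler_wpM2l ?expR_ge1Dx//.
  by rewrite (le_trans _ ae)// ltW.
rewrite qfD qfZ -/Q.
have c1 := ler_wpM2r Q0 b5.
have c2 := ler_wpM2r Q0 b4.
have c3 := ler_wpM2l (sqr_ge0 h) (ler_wpM2r Q0 b1).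
have a0 : 0 <= a by apply: le_trans ae; exact: ltW.
have c4 := ler_wpM2l (mulr_ge0 h0 a0) b2.
have c5 := ler_wpM2r Q0 (ler_wpM2l h0 (le_trans hh ae)).
have kE : k = nrm (gl 1%:M) + 1 by [].
move: (nrm (gl 1%:M)) (qf (gl (Z s)) y) (qf (gl 1%:M) y) (qf (Z (s + h)) y) (qf (Z s) y)
  (nrm (Z (s + h) - Z s - h *: gl (Z s))) (nrm (B *m (Z s + a *: 1%:M) *m B^T))
  (expR (k * (s + h))) kE E1 b3 c1 c2 c3 c4 c5 => g v1 v2 v3 v4 v5 v6 v7 ->.
move=> E1 b3 c1 c2 c3 c4 c5.
by clearbody a; rewrite !expr2 in c2 c3 E1 *; lra.
Qed.

End LyapunovFlow.

(** * Integral of the flow over the half-line *)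

Section LyapunovFlowIntegral.
Variables (R : realType) (n m : nat) (gamma : R).
Variables (B : 'M[R]_n) (K : 'I_m -> 'M[R]_n).
Notation mu := (@lebesgue_measure R).
Notation gl := (gen_lyapunov gamma B K).

(** Gronwall for the sum of squared entries. It serves to show that the flow stays symmetric, since
    [Z - Z^T] solves the same equation from 0. *)
Lemma lyapunov_flow_unique (D : R -> 'M[R]_n) : mx_primitive D (fun t => gl (D t)) ->
  D 0 = 0 -> forall T, 0 <= T -> D T = 0.
Proof.
move=> pD D0 T T0.
pose phi t := \sum_i \sum_j D t i j ^+ 2.
pose dphi t := \sum_i \sum_j 2 * D t i j * gl (D t) i j.
have pphi : primitive phi dphi.
  by apply: primitive_sum => i; apply: primitive_sum => j; apply: primitive_sqr (pD i j).
have leD t i j : D t i j ^+ 2 <= phi t.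
  rewrite /phi (bigD1 i) //= (bigD1 j) //= -addrA lerDl addr_ge0 //.
    by apply: sumr_ge0 => *; exact: sqr_ge0.
  by apply: sumr_ge0 => *; apply: sumr_ge0 => *; exact: sqr_ge0.
have phi0 t : 0 <= phi t by do 2! (apply: sumr_ge0 => ? _); exact: sqr_ge0.
pose k := \sum_i \sum_j \sum_a \sum_b 2 * `|gl (delta_mx a b) i j|.
have dle t : dphi t <= k * phi t.
  rewrite /dphi /k mulr_suml; apply: ler_sum => i _; rewrite mulr_suml.
  apply: ler_sum => j _; rewrite (linear_entries _ _ _ (gen_lyapunov_linear gamma B K)).
  rewrite mulr_sumr mulr_suml; apply: ler_sum => a _; rewrite mulr_sumr mulr_suml.
  apply: ler_sum => b _; set c := gl _ i j.
  have h1 := leD t i j; have h2 := leD t a b.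
  have h3 := sqr_ge0 (`|D t i j| - `|D t a b|).
  have h : `|D t i j| * `|D t a b| <= phi t.
    by rewrite -[D t i j ^+ 2]real_normK ?num_real// in h1;
       rewrite -[D t a b ^+ 2]real_normK ?num_real// in h2;
       move: h1 h2 h3; move: `|D t i j| `|D t a b| => x y; nra.
  have -> : 2 * D t i j * (c * D t a b) = 2 * (c * (D t i j * D t a b)) by ring.
  rewrite -mulrA ler_wpM2l// (le_trans (ler_norm _))// !normrM.
  by rewrite ler_wpM2l.
have pe := primitiveZ (- 1) (exp_damped_primitive k pphi).
have phi00 : phi 0 = 0.
  by rewrite /phi; do 2! (apply: big1 => ? _); rewrite D0 mxE expr0n.
have neg z : 0 <= z -> z <= T -> 0 <= - 1 * (expR (- k * z) * (dphi z - k * phi z)).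
  move=> _ _; rewrite mulN1r oppr_ge0 pmulr_rle0 ?expR_gt0// subr_le0.
  exact: dle.
have := primitive_le pe (lexx 0) T0 neg; rewrite phi00 !mulr0.
rewrite mulN1r oppr_ge0 pmulr_rle0 ?expR_gt0// => phiT.
apply/matrixP => i j; rewrite mxE; apply/eqP; rewrite -sqrf_eq0.
by apply/eqP/le_anti/andP; split; [exact: le_trans (leD T i j) phiT|exact: sqr_ge0].
Qed.

Variables (Z0 : 'M[R]_n) (Z : R -> 'M[R]_n).
Hypothesis odeZ : matrix_ode_solution gl Z0 Z.

Lemma ode_sym : Z0^T = Z0 -> forall T, 0 <= T -> (Z T)^T = Z T.
Proof.
move=> sZ0 T T0; apply/esym/eqP; rewrite -subr_eq0; apply/eqP.
apply: (lyapunov_flow_unique (D := fun t => Z t - (Z t)^T)) => //; last first.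
  by have [-> _ _] := odeZ; rewrite sZ0 subrr.
have lL : linear (fun W : 'M[R]_n => W - W^T).
  by move=> a U W; rewrite raddfD /= linearZ /= scalerBr opprD addrACA.
move=> i j; have := mx_primitive_linear lL (ode_primitive odeZ) i j.
by apply: eq_primitive => t _ //; rewrite gen_lyapunov_tr gen_lyapunovB.
Qed.

(** By [1 + x <= expR x] the damping loses at most [2 e T a], which vanishes with [e] at a fixed
    horizon. *)
Lemma le_of_exp_damped (a b T : R) : 0 <= T -> 0 <= a ->
  (forall e, 0 < e -> expR (- (2 * e) * T) * a <= b) -> a <= b.
Proof.
move=> T0 a0 h; apply/ler_addgt0Pr => e e0.
have d0 : 0 < 2 * T * a + 1 by have := mulr_ge0 (mulr_ge0 (ler0n R 2) T0) a0; lra.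
have := h _ (divr_gt0 e0 d0).
have := expR_ge1Dx (- (2 * (e / (2 * T * a + 1))) * T) => /(ler_wpM2r a0) h1 /(le_trans h1).
have h2 : 2 * T * a * (e / (2 * T * a + 1)) <= e.
  by rewrite mulrA ler_pdivrMr//; nra.
have -> : (1 + - (2 * (e / (2 * T * a + 1))) * T) * a =
  a - 2 * T * a * (e / (2 * T * a + 1)) by ring.
by lra.
Qed.

Lemma ode_entry_loc_int i j : loc_int (fun t => Z t i j).
Proof.
move=> S S0; apply: continuous_compact_integrable; first exact: segment_compact.
exact: primitive_continuous (ode_primitive odeZ i j) S0.
Qed.

Lemma qf_mx_integral (F : R -> 'M[R]_n) x T : (forall i j, loc_int (fun t => F t i j)) ->
  0 <= T -> qf (mx_integral_to F T) x = \int[mu]_(s in `[0, T]) qf (F s) x.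
Proof.
move=> IF T0; have [_] := qf_primitive x (mx_integral_primitive IF) T0.
by rewrite mx_integral_to0 qf0 add0r.
Qed.

Lemma qf_mx_integral_int (F : R -> 'M[R]_n) x : (forall i j, loc_int (fun t => F t i j)) ->
  loc_int (fun t => qf (F t) x).
Proof. by move=> IF; exact: primitive_int (qf_primitive x (mx_integral_primitive IF)). Qed.

Lemma psd_mx_integral (F : R -> 'M[R]_n) T : (forall i j, loc_int (fun t => F t i j)) ->
  (forall t, 0 <= t -> psd (F t)) -> 0 <= T -> psd (mx_integral_to F T).
Proof.
move=> IF Fp T0 x; rewrite qf_mx_integral//; apply: Rintegral_ge0 => s /=.
by rewrite in_itv/= => /andP[s0 _]; exact: Fp.
Qed.

Lemma qf_damped_integral_ge (F : R -> 'M[R]_n) e x T :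
  (forall i j, loc_int (fun t => F t i j)) ->
  (forall t, 0 <= t -> psd (F t)) -> 0 < e -> 0 <= T ->
  expR (- (2 * e) * T) * qf (mx_integral_to F T) x <=
  qf (mx_integral_to (fun t => expR (- (2 * e) * t) *: F t) T) x.
Proof.
move=> IF Fp e0 T0.
have IeF i j : loc_int (fun t => (expR (- (2 * e) * t) *: F t) i j).
  move=> S S0; have /(_ S S0) h := loc_intM (fun T T0 =>
    primitive_continuous (primitive_expR (primitive_linear_fun (- (2 * e)))) T0) (IF i j).
  by apply: eq_integrable h => // t _; rewrite /= mxE.
rewrite !qf_mx_integral// -RintegralZl//; last exact: qf_mx_integral_int IF T T0.
apply: le_Rintegral => //.
- exact: loc_intZ (qf_mx_integral_int x IF) T T0.
- exact: qf_mx_integral_int IeF T T0.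
move=> t /=; rewrite in_itv/= => /andP[t0 tT]; rewrite qfZ.
rewrite ler_wpM2r ?Fp// ler_expR !mulNr lerN2 ler_wpM2l//; lra.
Qed.

Lemma semistable_cert_shift V c e : V^T = V -> 0 < c ->
  (forall y, c * qf 1%:M y <= qf V y) ->
  (forall y, qf (gen_lyapunov gamma B^T (fun k => (K k)^T) V) y <= 0) -> 0 < e ->
  forall y, qf (gen_lyapunov gamma (B - e%:M)^T (fun k => (K k)^T) V) y
     <= - (2 * e * c) * qf 1%:M y.
Proof.
move=> sV c0 cV LV e0 y; rewrite raddfB /= tr_scalar_mx gen_lyapunov_shift qfB qfZ.
have e00 : 0 <= 2 * e by lra.
by have := LV y; have := ler_wpM2l e00 (cV y); lra.
Qed.

(** Comparison with a supersolution: the shifted operator maps [W] minus the damped integral to at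
    most [- 2 e W - expR (- 2 e T) Z T <= 0]. The shift is what turns the semistable [V] into a
    certificate. *)
Lemma ode_integral_le V c W : V^T = V -> 0 < c ->
  (forall y, c * qf 1%:M y <= qf V y) ->
  (forall y, qf (gen_lyapunov gamma B^T (fun k => (K k)^T) V) y <= 0) ->
  psd Z0 -> psd W -> (forall x, qf (gl W) x <= - qf Z0 x) ->
  forall T x, 0 <= T -> qf (mx_integral_to Z T) x <= qf W x.
Proof.
move=> sV c0 cV LV Z0p Wp LW T x T0.
have Zp := ode_psd odeZ Z0p.
apply: (le_of_exp_damped T0).
  exact: psd_mx_integral ode_entry_loc_int Zp T0 x.
move=> e e0; apply: (le_trans (qf_damped_integral_ge x ode_entry_loc_int Zp e0 T0)).
have k0 : 0 < Num.min c (2 * e * c) by rewrite lt_min c0 !mulr_gt0.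
have [|V' [c' cert]] := @stability_cert_adj _ _ _ gamma (B - e%:M) K V (Num.min c (2 * e * c)).
  split => // y; first by rewrite (le_trans _ (cV y))// ler_wpM2r ?qf1_ge0 ?ge_min ?lexx.
  apply: (le_trans (semistable_cert_shift sV c0 cV LV e0 y)).
  by rewrite ler_wpM2r ?qf1_ge0// lerN2 ge_min lexx orbT.
rewrite -subr_ge0 -qfB; apply: (psd_of_gen_lyapunov_le0 cert) => y.
rewrite gen_lyapunovB (ode_damped_integral odeZ _ T0) gen_lyapunov_shift !qfB !qfZ.
have := LW y; have := Wp y; have := mulr_ge0 (expR_ge0 (- (2 * e) * T)) (Zp T T0 y).
have e00 : 0 <= 2 * e by lra.
by move=> h1 h2 h3; have := mulr_ge0 e00 h2; lra.
Qed.

(** Each quadratic form of the integral is nondecreasing and bounded in [T]; the entries follow by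
    polarization, which is where symmetry of the flow enters. *)
Lemma ode_integral_converges W : psd Z0 -> Z0^T = Z0 ->
  (forall T x, 0 <= T -> qf (mx_integral_to Z T) x <= qf W x) ->
  mx_improper_converges Z.
Proof.
move=> Z0p sZ0 hW.
have Zp := ode_psd odeZ Z0p.
(* For negative [T] the interval is empty and the integral is 0, so monotonicity holds on the whole
   line. *)
have neg T : T < 0 -> mx_integral_to Z T = 0.
  move=> T0; apply/matrixP => i j; rewrite !mxE set_itv_ge ?Rintegral_set0//.
  by rewrite bnd_simp -ltNge.
have cq x : cvg (qf (mx_integral_to Z T) x @[T --> +oo]).
  apply/cvg_ex; eexists; apply: nondecreasing_cvgr.
    move=> s t st; case: (ltP s 0) => [s0|s0].
      rewrite neg// qf0; case: (ltP t 0) => [t0|t0]; first by rewrite neg// qf0.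
      exact: psd_mx_integral ode_entry_loc_int Zp t0 x.
    apply: (primitive_le (qf_primitive x (mx_integral_primitive ode_entry_loc_int)) s0 st).
    by move=> z sz _; apply: Zp; exact: le_trans s0 sz.
  exists (Num.max 0 (qf W x)) => _ [T _ <-].
  case: (ltP T 0) => T0; first by rewrite neg// qf0 le_max lexx.
  by rewrite le_max hW ?orbT.
have sI T : (mx_integral_to Z T)^T = mx_integral_to Z T.
  apply/matrixP => i j; rewrite !mxE; apply: eq_Rintegral => s.
  by rewrite inE/= in_itv/= => /andP[s0 _]; rewrite -[in LHS](ode_sym sZ0 s0) mxE.
move=> i j; pose d1 : 'cV[R]_n := delta_mx i 0; pose d2 : 'cV[R]_n := delta_mx j 0.
have -> : (fun T => mx_integral_to Z T i j) = (fun T => 2^-1 *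
    (qf (mx_integral_to Z T) (d1 + d2) - qf (mx_integral_to Z T) d1
      - qf (mx_integral_to Z T) d2)).
  apply/funext => T; rewrite (qf_polar _ _ (sI T)).
  have -> : d1^T *m mx_integral_to Z T *m d2 = (mx_integral_to Z T i j)%:M.
    apply/matrixP => a b; rewrite !ord1 /d1 /d2 trmx_delta -rowE -colE !mxE.
    by rewrite eqxx.
  rewrite [(_%:M) 0 0]mxE eqxx mulr1n.
  by move: (mx_integral_to Z T i j) (qf _ d1) (qf _ d2) => a b c; field.
apply: is_cvgM; first exact: is_cvg_cst.
by apply: is_cvgB => //; exact: is_cvgB.
Qed.

Section Limit.
Hypothesis cvgZ : mx_improper_converges Z.
Let P := mx_improper_integral Z.

Lemma mx_integral_cvg i j : mx_integral_to Z T i j @[T --> +oo] --> P i j.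
Proof. by rewrite /P mxE; exact: cvgZ. Qed.

Lemma psd_mx_improper_integral : psd Z0 -> psd P.
Proof.
move=> Z0p x.
have c : qf (mx_integral_to Z T) x @[T --> +oo] --> qf P x.
  rewrite qfE (_ : (fun T => _) = (fun T => \sum_i \sum_j
    x i 0 * mx_integral_to Z T i j * x j 0)); last by apply/funext => T; rewrite qfE.
  apply: cvg_sum_ord => i; apply: cvg_sum_ord => j.
  apply: cvgM; last exact: cvg_cst.
  by apply: cvgM; [exact: cvg_cst|exact: mx_integral_cvg].
apply: (cvgr_to_ge c); near=> T.
apply: psd_mx_integral => //; first exact: ode_entry_loc_int.
exact: ode_psd odeZ Z0p.
Unshelve. all: by end_near. Qed.

(** From [L (int_0^T Z) = Z T - Z0] it follows that [Z T] converges to [L P + Z0]. Its integral over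
    [[T, T + 1]] tends both to this limit and, by convergence of the improper integral, to 0. *)
Lemma gen_lyapunov_mx_improper_integral : gl P = - Z0.
Proof.
apply/matrixP => i j; rewrite [RHS]mxE; apply/eqP; rewrite -subr_eq0 opprK.
set l := gl P i j + Z0 i j.
have cZ : Z T i j @[T --> +oo] --> l.
  have h : (gl (mx_integral_to Z T) i j + Z0 i j) @[T --> +oo] --> l.
    apply: cvgD; last exact: cvg_cst.
    rewrite (linear_entries P i j (gen_lyapunov_linear gamma B K)).
    rewrite (_ : (fun T => _) = (fun T => \sum_k \sum_l0
      gl (delta_mx k l0) i j * mx_integral_to Z T k l0)); last first.
      by apply/funext => T; rewrite (linear_entries _ _ _ (gen_lyapunov_linear gamma B K)).
    apply: cvg_sum_ord => a; apply: cvg_sum_ord => b.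
    by apply: cvgM; [exact: cvg_cst|exact: mx_integral_cvg].
  apply: cvg_trans h; apply: near_eq_cvg; near=> T.
  rewrite (ode_integral odeZ); last by near: T; exact: nbhs_pinfty_ge.
  by rewrite [X in X + _]mxE [X in _ + X + _]mxE subrK.
have c1 : (mx_integral_to Z (T + 1) i j - mx_integral_to Z T i j) @[T --> +oo] --> (0 : R).
  rewrite -[X in _ --> X](subrr (P i j)); apply: cvgB; last exact: mx_integral_cvg.
  by rewrite (cvg_shiftr 1 (fun T => mx_integral_to Z T i j)); exact: mx_integral_cvg.
rewrite -normr_le0; apply/ler_addgt0Pr => e e0; rewrite add0r.
have e2 : 0 < e / 2 by rewrite divr_gt0.
have [T [T0 h1 h2]] : exists T, [/\ 0 <= T,
   `|mx_integral_to Z (T + 1) i j - mx_integral_to Z T i j| <= e / 2 &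
   forall s, T <= s -> `|Z s i j - l| <= e / 2].
  have [M [_ hM]] : \forall T \near +oo, `|Z T i j - l| <= e / 2.
    by move/cvgrPdist_le : cZ => /(_ _ e2); apply: filterS => T; rewrite distrC.
  have [M' [_ hM']] : \forall T \near +oo,
      `|mx_integral_to Z (T + 1) i j - mx_integral_to Z T i j| <= e / 2.
    by move/cvgrPdist_le : c1 => /(_ _ e2); apply: filterS => T; rewrite sub0r normrN.
  exists (`|M| + `|M'| + 1); split.
  - by rewrite !addr_ge0.
  - by apply: hM'; have := ler_norm M'; have := normr_ge0 M; lra.
  by move=> s Ts; apply: hM; have := ler_norm M; have := normr_ge0 M'; lra.
have pI := primitiveD (mx_integral_primitive ode_entry_loc_int i j) (primitive_linear_fun (- l)).
have T1 : T <= T + 1 by rewrite lerDl.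
have := primitive_lip pI T0 T1 (fun z Tz _ => h2 z Tz).
have -> : mx_integral_to Z (T + 1) i j + - l * (T + 1) - (mx_integral_to Z T i j + - l * T) =
  (mx_integral_to Z (T + 1) i j - mx_integral_to Z T i j) - l by ring.
have -> : T + 1 - T = 1 by ring.
move: h1; move: (_ - _) => a h1 h3.
have -> : l = a - (a - l) by ring.
by apply: (le_trans (ler_normB _ _)); lra.
Unshelve. all: by end_near. Qed.

End Limit.

End LyapunovFlowIntegral.

(** * L2 norms *)

Section L2Norm.
Variable R : realType.
Notation mu := (@lebesgue_measure R).

Lemma norm2_sqr n (v : 'cV[R]_n) : norm2 v ^+ 2 = qf 1%:M v.
Proof. by rewrite qf1E /norm2 sqr_sqrtr//; apply: sumr_ge0 => i _; exact: sqr_ge0. Qed.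

Lemma L2norm_sqr n (f : R -> 'cV[R]_n) :
  (L2norm f `^ 2 = \int[mu]_(s in `[0%R, +oo[) (qf 1%:M (f s))%:E)%E.
Proof.
rewrite /L2norm poweR_Lnorm ?pnatr_eq0// [RHS]integral_mkcond.
apply: eq_integral => s _; rewrite !patchE; case: ifPn => _ /=.
  by rewrite ger0_norm ?sqrtr_ge0// powR_mulrn ?sqrtr_ge0// norm2_sqr.
by rewrite normr0 powR0 ?pnatr_eq0.
Qed.

(** Monotone convergence along integer horizons; measurability on the half-line is also recovered
    from the bounded intervals. *)
Lemma L2norm_le n (f : R -> 'cV[R]_n) (c : R) : 0 <= c ->
  (forall T, 0 <= T -> mu.-integrable `[0, T] (EFin \o (fun s => qf 1%:M (f s)))) ->
  (forall T, 0 <= T -> \int[mu]_(s in `[0, T]) qf 1%:M (f s) <= c ^+ 2) ->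
  (L2norm f <= c%:E)%E.
Proof.
move=> c0 If hf.
have h : (L2norm f `^ 2 <= (c ^+ 2)%:E)%E.
  rewrite L2norm_sqr; pose F := (fun s => qf 1%:M (f s)) \_ `[0, +oo[.
  have FE T : (\int[mu]_(s in `[0%R, T]) (F s)%:E = \int[mu]_(s in `[0%R, T]) (qf 1%:M (f s))%:E)%E.
    apply: eq_integral => s; rewrite inE/= in_itv/= => /andP[s0 _].
    by rewrite /F patchE mem_set//= in_itv/= s0.
  have -> : (\int[mu]_(s in `[0%R, +oo[) (qf 1%:M (f s))%:E =
      \int[mu]_(s in `[0%R, +oo[) (F s)%:E)%E.
    by apply: eq_integral => s sD; rewrite /F patchE sD.
  have mfn (k : nat) : measurable_fun (`[0, k%:R]%classic : set R) (fun s => qf 1%:M (f s)).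
    apply/measurable_EFinP; exact: (measurable_int mu (If k%:R (ler0n _ _))).
  have mF : measurable_fun setT F.
    apply/(measurable_restrictT _ _).1 => //.
    have -> : `[0, +oo[%classic = \bigcup_k (`[0, k%:R]%classic : set R).
      apply/seteqP; split => [s /=|s [k _ /=]]; rewrite !in_itv/= ?andbT; last by case/andP.
      move=> s0; exists (Num.bound s) => //=; rewrite in_itv/= s0/=.
      by apply: ltW; exact: archi_boundP.
    by apply/measurable_fun_bigcup.
  rewrite ge0_integral_ereal_sup//; last first.
    by move=> s; rewrite /F patchE; case: ifP => // _; exact: qf1_ge0.
  apply: ge_ereal_sup => _ [k _ <-]; rewrite FE.
  have k0 : 0 <= k.+1%:R :> R by exact: ler0n.
  have := hf _ k0; rewrite -lee_fin /Rintegral fineK//.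
  exact: integrable_fin_num (If _ k0).
have : (0 <= L2norm f)%E by exact: Lnorm_ge0.
move: h; case: (L2norm f) => [r||//].
  rewrite poweR_EFin !lee_fin => h r0; rewrite powR_mulrn// in h.
  by rewrite -ler_sqr ?nnegrE.
by rewrite poweRyr// pnatr_eq0.
Qed.

Lemma in_L2_loc_int n (f : R -> 'cV[R]_n) : in_L2 f ->
  loc_int (fun s => qf 1%:M (f s)) /\
  forall T, 0 <= T -> \int[mu]_(s in `[0, T]) qf 1%:M (f s) <= fine (L2norm f) ^+ 2.
Proof.
move=> [mf Lf].
have L0 : (0 <= L2norm f)%E by exact: Lnorm_ge0.
have Lfin : L2norm f \is a fin_num by rewrite ge0_fin_numE.
have e : (\int[mu]_(s in `[0%R, +oo[) (qf 1%:M (f s))%:E = (fine (L2norm f) ^+ 2)%:E)%E.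
  by rewrite -L2norm_sqr -[in LHS](fineK Lfin) poweR_EFin powR_mulrn ?fine_ge0.
have mq : measurable_fun (`[0, +oo[%classic : set R) (fun s => qf 1%:M (f s)).
  rewrite (_ : (fun s => _) = (fun s => \sum_i f s i 0 ^+ 2)); last first.
    by apply/funext => s; rewrite qf1E.
  by apply: measurable_sum => i; apply: measurable_funX; exact: mf.
have Iy : mu.-integrable `[0, +oo[ (EFin \o (fun s => qf 1%:M (f s))).
  apply/integrableP; split; first exact/measurable_EFinP.
  by under eq_integral do rewrite /= ger0_norm ?qf1_ge0//; rewrite e ltry.
have sub T : (`[0, T] : set R) `<=` `[0, +oo[.
  by move=> z /=; rewrite !in_itv/= => /andP[->].
have Il : loc_int (fun s => qf 1%:M (f s)).
  by move=> T T0; apply: integrableS Iy => //; exact: sub.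
split => // T T0; rewrite -lee_fin -e /Rintegral fineK; last first.
  exact: integrable_fin_num (Il T T0).
apply: ge0_subset_integral => //; first exact/measurable_EFinP.
by move=> s _; rewrite lee_fin qf1_ge0.
Qed.

(** On bounded intervals L2 is contained in L1, by domination of an entry [a] by [1 + a^2]. *)
Lemma in_L2_entry_loc_int n (f : R -> 'cV[R]_n) i : in_L2 f -> loc_int (fun s => f s i 0).
Proof.
move=> fL; have [Il _] := in_L2_loc_int fL; have [mf _] := fL.
have I1 : loc_int (fun s => 1 + qf 1%:M (f s)).
  by apply: loc_intD Il; exact: primitive_int (primitive_linear_fun 1).
move=> T T0; apply: le_integrable (I1 T T0) => //.
  apply/measurable_EFinP; apply: measurable_funS (mf i) => //.
  by move=> z /=; rewrite !in_itv/= => /andP[->].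
move=> s _ /=; rewrite lee_fin [leRHS]ger0_norm; last by rewrite addr_ge0// qf1_ge0.
have : f s i 0 ^+ 2 <= qf 1%:M (f s).
  by rewrite qf1E (bigD1 i) //= lerDl; apply: sumr_ge0 => *; exact: sqr_ge0.
have := sqr_ge0 (`|f s i 0| - 1); rewrite -(real_normK (num_real (f s i 0))).
by move: `|f s i 0| => a; nra.
Qed.

End L2Norm.

(** * The energy inequality *)

Section Energy.
Variables (R : realType) (n m : nat) (gamma : R).
Notation mu := (@lebesgue_measure R).

Lemma qf_outer k (z : 'cV[R]_k) w : qf (z *m z^T) w = (w^T *m z) 0 0 ^+ 2.
Proof.
rewrite /qf mulmxA -[w^T *m z *m z^T *m w]mulmxA mxE big_ord1 expr2; congr (_ * _).
have -> : z^T *m w = (w^T *m z)^T by rewrite trmx_mul trmxK.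
by rewrite mxE.
Qed.

(** Cauchy-Schwarz for [v] and [X^T w]. It relates the initial state of one trajectory to the
    right-hand side of the Gramian equation and is the origin of the factor [norm2 v0]. *)
Lemma qf_outer_mul_le k q (X : 'M[R]_(k, q)) v w :
  qf ((X *m v) *m (X *m v)^T) w <= qf 1%:M v * qf (X *m X^T) w.
Proof.
rewrite qf_outer mulmxA.
have -> : qf (X *m X^T) w = qf 1%:M (X^T *m w) by rewrite -qf_congr mulmx1.
have -> : w^T *m X = (X^T *m w)^T by rewrite trmx_mul trmxK.
move: (X^T *m w) => a; rewrite mxE !qf1E.
under eq_bigr do rewrite mxE.
have expand (s p : R) : \sum_i (s * v i 0 - p * a i 0) ^+ 2 =
    s ^+ 2 * (\sum_i v i 0 ^+ 2) - 2 * s * p * (\sum_i a i 0 * v i 0)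
    + p ^+ 2 * \sum_i a i 0 ^+ 2.
  by rewrite !mulr_sumr -sumrB -big_split; apply: eq_bigr => i _ /=; ring.
have [s0|s0] := eqVneq (\sum_i a i 0 ^+ 2) 0.
  have a0 i : a i 0 = 0.
    move/eqP: s0; rewrite psumr_eq0 => [/allP/(_ i (mem_index_enum _))|*]; last exact: sqr_ge0.
    by rewrite sqrf_eq0 => /eqP.
  rewrite s0 mulr0 big1 ?expr0n// => i _; by rewrite a0 mul0r.
set s := \sum_i a i 0 ^+ 2 in s0 *; set p := \sum_i _; set t := \sum_i v i 0 ^+ 2.
have sp : 0 < s.
  by rewrite lt_neqAle eq_sym s0; apply: sumr_ge0 => *; exact: sqr_ge0.
have : 0 <= \sum_i (s * v i 0 - p * a i 0) ^+ 2 by apply: sumr_ge0 => *; exact: sqr_ge0.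
rewrite expand -/s -/p -/t.
have -> : s ^+ 2 * t - 2 * s * p * p + p ^+ 2 * s = s * (t * s - p ^+ 2) by ring.
by rewrite pmulr_rge0// subr_ge0.
Qed.

Variables (A : 'M[R]_n) (N : 'I_m -> 'M[R]_n) (u v : 'I_m -> R -> R) (z : R -> 'cV[R]_n).
Hypothesis gamma_gt0 : 0 < gamma.
Hypothesis pz : mx_primitive z (fun t => A *m z t + \sum_k u k t *: (N k *m z t)).
Hypothesis uv : forall k, (forall t, v k t = u k t) \/ N k = 0.
Hypothesis Iv : loc_int (fun t => \sum_k v k t ^+ 2).

Definition gronwall_weight e t : R :=
  expR (- (gamma ^+ 2 * \int[mu]_(s in `[0, t]) (\sum_k v k s ^+ 2)) - (2 * e) * t).

Definition weighted_outer e t := gronwall_weight e t *: (z t *m (z t)^T).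

Lemma gronwall_weight_primitive e : primitive (gronwall_weight e)
  (fun t => - gronwall_weight e t * (gamma ^+ 2 * (\sum_k v k t ^+ 2) + 2 * e)).
Proof.
have h1 := primitiveZ (- gamma ^+ 2) (loc_int_primitive Iv).
have h2 := primitiveD h1 (primitive_linear_fun (- (2 * e))).
apply: eq_primitive (primitive_expR h2) => t _ /=; rewrite /gronwall_weight.
  by congr expR; rewrite !mulNr.
by rewrite !mulNr; ring.
Qed.

Lemma weighted_outer_loc_int e i j : loc_int (fun t => weighted_outer e t i j).
Proof.
have h := primitiveM (gronwall_weight_primitive e) (primitiveM (pz i 0) (pz j 0)).
have {}h := eq_primitive (G := fun t => weighted_outer e t i j) _ (fun _ _ => erefl) h.
move=> T T0; apply: continuous_compact_integrable; first exact: segment_compact.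
apply: (primitive_continuous (h _) T0) => t _.
by rewrite /weighted_outer !mxE big_ord1 mxE.
Qed.

(** Testing with a fixed [w] reduces the matrix inequality to the scalar [xi = w^T z]: the
    derivative of [g xi^2] is at most the form of the shifted operator at [g z z^T]. After
    integration the end value [g xi^2] at [T] is dropped, being nonnegative. Here [v] plays the role
    of [u^0], and differs from [u] only where the coupling matrix vanishes. *)
Lemma gen_lyapunov_energy e T w : 0 <= T ->
  - qf (z 0 *m (z 0)^T) w <=
  qf (gen_lyapunov gamma (A - e%:M) N (mx_integral_to (weighted_outer e) T)) w.
Proof.
move=> T0; pose xi t := (w^T *m z t) 0 0.
pose al t := (w^T *m (A *m z t)) 0 0; pose be k t := (w^T *m (N k *m z t)) 0 0.
pose g := gronwall_weight e.
have pxi : primitive xi (fun t => al t + \sum_k u k t * be k t).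
  have lw : linear (fun y : 'cV[R]_n => w^T *m y).
    by move=> a y1 y2; rewrite mulmxDr -scalemxAr.
  apply: eq_primitive (mx_primitive_linear lw pz 0 0) => t _ //.
  rewrite mulmxDr mxE mulmx_sumr summxE; congr (_ + _); apply: eq_bigr => k _.
  by rewrite -scalemxAr mxE.
have pI := mx_primitive_linear (gen_lyapunov_linear gamma (A - e%:M) N)
  (mx_integral_primitive (weighted_outer_loc_int e)).
have pq := qf_primitive w pI.
have pg := primitiveM (gronwall_weight_primitive e) (primitive_sqr pxi).
have qE t : qf (gen_lyapunov gamma (A - e%:M) N (weighted_outer e t)) w =
    g t * (2 * al t * xi t + gamma ^- 2 * (\sum_k be k t ^+ 2) - 2 * e * xi t ^+ 2).
  rewrite gen_lyapunovZ gen_lyapunov_shift gen_lyapunovE qfZ -/(g t); congr (_ * _).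
  rewrite qfB !qfD !qfZ qf_outer -/(xi t) qf_sum.
  have e1 : qf (A *m (z t *m (z t)^T)) w = al t * xi t.
    rewrite /qf !mulmxA -[_ *m (z t)^T *m w]mulmxA mxE big_ord1 /al mulmxA.
    congr (_ * _); have -> : (z t)^T *m w = (w^T *m z t)^T by rewrite trmx_mul trmxK.
    by rewrite mxE.
  have e2 : qf (z t *m (z t)^T *m A^T) w = al t * xi t.
    by rewrite -e1 -qf_tr !trmx_mul !trmxK mulmxA.
  have e3 k : qf (N k *m (z t *m (z t)^T) *m (N k)^T) w = be k t ^+ 2.
    by rewrite /be -qf_outer trmx_mul !mulmxA.
  by under eq_bigr do rewrite e3; rewrite e1 e2; ring.
have := primitive_le (primitiveD pq (primitiveZ (- 1) pg)) (lexx 0) T0.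
rewrite mx_integral_to0 gen_lyapunov0 qf0 add0r.
have -> : gronwall_weight e 0 = 1.
  by rewrite /gronwall_weight set_itv1 Rintegral_set1 !mulr0 !oppr0 addr0 expR0.
move=> h; have {}h : - 1 * (1 * xi 0 ^+ 2) <=
   qf (gen_lyapunov gamma (A - e%:M) N (mx_integral_to (weighted_outer e) T)) w +
   - 1 * (gronwall_weight e T * xi T ^+ 2).
  apply: h => t _ _; rewrite qE -/(g t).
  have -> : g t * (2 * al t * xi t + gamma ^- 2 * (\sum_k be k t ^+ 2) - 2 * e * xi t ^+ 2) +
     - 1 * (- g t * (gamma ^+ 2 * (\sum_k v k t ^+ 2) + 2 * e) * xi t ^+ 2 +
        g t * (2 * xi t * (al t + \sum_k u k t * be k t))) =
     g t * (gamma ^- 2 * (\sum_k be k t ^+ 2) + gamma ^+ 2 * xi t ^+ 2 * (\sum_k v k t ^+ 2)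
        - 2 * xi t * (\sum_k u k t * be k t)) by ring.
  apply: mulr_ge0; first exact: expR_ge0.
  rewrite !mulr_sumr -big_split /= -sumrB; apply: sumr_ge0 => k _.
  (* A complete square when [v k = u k]; when [N k = 0] the cross term is zero and the remaining
     term is nonnegative. *)
  case: (uv k) => [->|Nk0].
    have -> : gamma ^- 2 * be k t ^+ 2 + gamma ^+ 2 * xi t ^+ 2 * u k t ^+ 2 -
        2 * xi t * (u k t * be k t) = (gamma^-1 * be k t - gamma * xi t * u k t) ^+ 2.
      by field; rewrite gt_eqF.
    exact: sqr_ge0.
  have -> : be k t = 0 by rewrite /be Nk0 mul0mx mulmx0 mxE.
  rewrite expr0n /= !mulr0 subr0 add0r; by rewrite mulr_ge0 ?sqr_ge0// mulr_ge0 ?sqr_ge0.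
have := mulr_ge0 (expR_ge0 _ : 0 <= gronwall_weight e T) (sqr_ge0 (xi T)).
by rewrite qf_outer -/(xi 0); lra.
Qed.

End Energy.

(** * From the Gramian to the output energy *)

Section OutputEnergy.
Variables (R : realType) (n m p q : nat) (gamma : R).
Notation mu := (@lebesgue_measure R).

Lemma mxtrace_congr_qf k l (C : 'M[R]_(l, k)) (M : 'M[R]_k) :
  \tr (C *m M *m C^T) = \sum_i qf M (row i C)^T.
Proof.
apply: eq_bigr => i _; rewrite /qf trmxK -row_mul [LHS]mxE [RHS]mxE.
by apply: eq_bigr => j _; rewrite [_^T j i]mxE [row i _ 0 j]mxE [_^T j 0]mxE [row i C 0 j]mxE.
Qed.

Variables (A : 'M[R]_n) (N : 'I_m -> 'M[R]_n) (u v : 'I_m -> R -> R) (z : R -> 'cV[R]_n).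
Hypothesis gamma_gt0 : 0 < gamma.
Hypothesis pz : mx_primitive z (fun t => A *m z t + \sum_k u k t *: (N k *m z t)).
Hypothesis uv : forall k, (forall t, v k t = u k t) \/ N k = 0.
Hypothesis Iv : loc_int (fun t => \sum_k v k t ^+ 2).
Variable G : R.
Hypothesis vG : forall T, 0 <= T ->
  gamma ^+ 2 * \int[mu]_(s in `[0, T]) (\sum_k v k s ^+ 2) <= G.

Lemma output_loc_int (C : 'M[R]_(p, n)) : loc_int (fun t => qf 1%:M (C *m z t)).
Proof.
have lC : linear (fun y : 'cV[R]_n => C *m y).
  by move=> a y1 y2; rewrite mulmxDr -scalemxAr.
have h := primitive_sum (fun i => primitive_sqr (mx_primitive_linear lC pz i 0)).
move=> T T0; apply: continuous_compact_integrable; first exact: segment_compact.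
have {}h := eq_primitive (G := fun t => qf 1%:M (C *m z t)) _ (fun _ _ => erefl) h.
by apply: (primitive_continuous (h _) T0) => t _; rewrite qf1E.
Qed.

(** Inverse positivity gives [int_0^T g z z^T <= |v0|^2 P]; summing over the rows of [C] produces
    the trace, and the weight is at least [expR (- 2 e T) expR (- G)] up to time [T]. *)
Lemma output_energy_bound (C : 'M[R]_(p, n)) (X : 'M[R]_(n, q)) v0 P :
  z 0 = X *m v0 -> psd P -> gen_lyapunov gamma A N P = - (X *m X^T) ->
  (forall e, 0 < e -> exists V c, stability_cert gamma (A - e%:M) N V c) ->
  forall T, 0 <= T -> \int[mu]_(s in `[0, T]) qf 1%:M (C *m z s) <=
    expR G * qf 1%:M v0 * \tr (C *m P *m C^T).
Proof.
move=> z0 Pp LP cert T T0; set a := Rintegral _ _ _.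
have IC := output_loc_int C.
have a0 : 0 <= a by apply: Rintegral_ge0 => s _; exact: qf1_ge0.
(* The factor [expR G] is moved to the left so that only the damping in [e] remains to be
   removed. *)
suff : expR (- G) * a <= qf 1%:M v0 * \tr (C *m P *m C^T).
  move=> /(ler_wpM2l (expR_ge0 G)).
  by rewrite mulrA -expRD subrr expR0 mul1r mulrA.
apply: (le_of_exp_damped T0); first exact: mulr_ge0 (expR_ge0 _) a0.
move=> e e0; pose W := weighted_outer gamma v z e.
have IW i j : loc_int (fun t => W t i j) by exact: (weighted_outer_loc_int gamma pz Iv).
have MP w : qf (mx_integral_to W T) w <= qf 1%:M v0 * qf P w.
  rewrite -qfZ -subr_ge0 -qfB; have [V [c ce]] := cert e e0.
  apply: (psd_of_gen_lyapunov_le0 ce) => y.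
  rewrite gen_lyapunovB gen_lyapunovZ gen_lyapunov_shift LP.
  have := gen_lyapunov_energy gamma_gt0 pz uv Iv e y T0; rewrite -/W.
  move: (gen_lyapunov _ _ _ (mx_integral_to W T)) => M h1.
  have := qf_outer_mul_le X v0 y; rewrite -z0 => h2.
  rewrite qfB qfZ qfB qfN qfZ.
  have h3 := mulr_ge0 (qf1_ge0 v0) (mulr_ge0 (ltW e0) (Pp y)).
  by lra.
rewrite (mxtrace_congr_qf C) mulr_sumr.
apply: (@le_trans _ _ (\sum_i qf (mx_integral_to W T) (row i C)^T)); last first.
  by apply: ler_sum => i _; exact: MP.
have p1 := primitive_sum (fun i => qf_primitive (row i C)^T (mx_integral_primitive IW)).
have p2 := primitiveZ (- (expR (- (2 * e) * T) * expR (- G))) (loc_int_primitive IC).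
have neg t : 0 <= t -> t <= T -> 0 <= \sum_i qf (W t) (row i C)^T +
    - (expR (- (2 * e) * T) * expR (- G)) * qf 1%:M (C *m z t).
  move=> t0 tT; rewrite mulNr subr_ge0.
  have -> : \sum_i qf (W t) (row i C)^T = gronwall_weight gamma v e t * qf 1%:M (C *m z t).
    rewrite qf1E mulr_sumr; apply: eq_bigr => i _; rewrite qfZ qf_outer trmxK.
    by rewrite -row_mul mxE.
  rewrite ler_wpM2r ?qf1_ge0// -expRD ler_expR [leRHS]addrC lerD//.
    by rewrite !mulNr lerN2 ler_wpM2l//; lra.
  by rewrite lerN2 vG.
have := primitive_le (primitiveD p1 p2) (lexx 0) T0 neg.
rewrite mx_integral_to0 set_itv1 Rintegral_set1 mulr0 addr0 -/a.
under eq_bigr do rewrite qf0; rewrite big1//.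
by rewrite mulNr subr_ge0 mulrA.
Qed.

End OutputEnergy.

(** * Change of coordinates *)

Section Similarity.
Variables (R : realType) (n m : nat) (gamma : R).

Lemma gen_lyapunov_similar (S A : 'M[R]_n) (N : 'I_m -> 'M[R]_n) Z : S \in unitmx ->
  gen_lyapunov gamma (S *m A *m invmx S) (fun k => S *m N k *m invmx S) (S *m Z *m S^T)
  = S *m gen_lyapunov gamma A N Z *m S^T.
Proof.
move=> uS; rewrite !gen_lyapunovE.
have cl (M : 'M[R]_n) : S *m M *m invmx S *m (S *m Z *m S^T) = S *m (M *m Z) *m S^T.
  by rewrite !mulmxA mulmxKV.
have cr (M W : 'M[R]_n) : S *m W *m S^T *m (S *m M *m invmx S)^T = S *m (W *m M^T) *m S^T.
  by rewrite !trmx_mul !mulmxA -[_ *m S^T *m (invmx S)^T]mulmxA -trmx_mul mulVmx// trmx1 mulmx1.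
rewrite cl cr !mulmxDr !mulmxDl -scalemxAr -scalemxAl; congr (_ + _ *: _).
rewrite mulmx_sumr mulmx_suml; apply: eq_bigr => k _.
by rewrite cl cr.
Qed.

Lemma tr_similar (S A : 'M[R]_n) : S \in unitmx ->
  (S *m A *m invmx S)^T = (invmx S)^T *m A^T *m invmx (invmx S)^T.
Proof. by move=> uS; rewrite !trmx_mul -trmx_inv invmxK mulmxA. Qed.

(** An eigenmatrix of the balanced adjoint is carried back to the original coordinates, where the
    spectral hypothesis applies. Only its real nonnegative part is tested, as
    [stability_cert_exists] requires. *)
Lemma stable_kron_cert_similar (S A : 'M[R]_n) (N : 'I_m -> 'M[R]_n) : S \in unitmx ->
  stable_spectrum (kron_lyapunov gamma A N) ->
  exists V c, stability_cert gamma (S *m A *m invmx S)^T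
    (fun k => (S *m N k *m invmx S)^T) V c.
Proof.
move=> uS st; apply: stability_cert_exists => s s0 V _ LV.
set T := (invmx S)^T; have uT : T \in unitmx by rewrite unitmx_tr unitmx_inv.
set W := invmx T *m V *m (invmx T)^T.
have VW : V = T *m W *m T^T.
  rewrite /W !mulmxA mulmxV// mul1mx -mulmxA -trmx_mul mulmxV// trmx1.
  by rewrite mulmx1.
have : gen_lyapunov gamma A^T (fun k => (N k)^T) W = s *: W.
  move: LV; rewrite tr_similar// (_ : (fun k => _) = fun k => T *m (N k)^T *m invmx T); last first.
    by apply/funext => k; rewrite tr_similar.
  rewrite VW gen_lyapunov_similar// scalemxAl scalemxAr.
  move=> /(congr1 (fun M => invmx T *m M *m (invmx T)^T)).
  have K (M : 'M[R]_n) : invmx T *m (T *m M *m T^T) *m (invmx T)^T = M.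
    by rewrite !mulmxA mulVmx// mul1mx -mulmxA -trmx_mul mulVmx// trmx1 mulmx1.
  by rewrite !K.
move=> LW; have W0 : W = 0.
  apply/eqP/negPn/negP => /(gen_lyapunov_kron_eigen LW).
  by rewrite -(eigenvalue_map (real_complex R)) => /st /=; rewrite ltNge s0.
by rewrite VW W0 mulmx0 mul0mx.
Qed.

End Similarity.

(** * Trajectories and the effective control *)

Section BilinearSystem.
Variables (R : realType) (n m : nat).
Notation mu := (@lebesgue_measure R).

Lemma bilinear_solution_primitive (A : 'M[R]_n) (N : 'I_m -> 'M[R]_n)
    (u : R -> 'cV[R]_m) x0 (x : R -> 'cV[R]_n) :
  (forall k, loc_int (fun s => u s k 0)) -> bilinear_solution A N u x0 x ->
  x 0 = x0 /\ mx_primitive x (fun t => A *m x t + \sum_k u t k 0 *: (N k *m x t)).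
Proof.
move=> Iu [cx xE].
have x00 : x 0 = x0.
  apply/matrixP => i j; rewrite ord1 (xE 0 (lexx 0)) set_itv1.
  by rewrite Rintegral_set1 addr0.
have cxi (T : R) i : {within `[0, T], continuous (fun t => x t i 0)}.
  have sub : (`[0, T] : set R) `<=` `[0, +oo[.
    by move=> z /=; rewrite !in_itv/= => /andP[->].
  move=> t; have := @continuous_comp (subspace (`[0, T] : set R)) 'cV[R]_n R x
    (fun M => M i 0) t.
  by apply; [exact: continuous_subspaceW sub cx t|exact: coord_continuous].
have cMx (M : 'M[R]_n) i (T : R) : {within `[0, T], continuous (fun t => (M *m x t) i 0)}.
  rewrite (_ : (fun t => _) = (fun t => \sum_j M i j * x t j 0)); last first.
    by apply/funext => t; rewrite mxE.
  move=> t; apply: cvg_sum_ord => j.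
  by apply: cvgM; [exact: cvg_cst|exact: cxi].
split => // i j; rewrite ord1.
have fE t : (A *m x t + \sum_k u t k 0 *: (N k *m x t)) i 0 =
    (A *m x t) i 0 + \sum_k (N k *m x t) i 0 * u t k 0.
  rewrite mxE summxE; congr (_ + _); apply: eq_bigr => k _.
  by rewrite mxE mulrC.
have If : loc_int (fun t => (A *m x t + \sum_k u t k 0 *: (N k *m x t)) i 0).
  have I1 : loc_int (fun t => (A *m x t) i 0).
    by move=> T T0; apply: continuous_compact_integrable; [exact: segment_compact|exact: cMx].
  have I2 : loc_int (fun t => \sum_k (N k *m x t) i 0 * u t k 0).
    have Ik k := loc_intM (fun T _ => cMx (N k) i T) (Iu k).
    exact: primitive_int (primitive_sum (fun k => loc_int_primitive (Ik k))).
  have I3 := loc_int_primitive (loc_intD I1 I2).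
  exact: primitive_int (eq_primitive (fun _ _ => erefl) (fun t _ => esym (fE t)) I3).
move=> T T0; split; first exact: If.
by rewrite x00; exact: xE.
Qed.

Lemma qf_scale_ctrl0 (N : 'I_m -> 'M[R]_n) (u : R -> 'cV[R]_m) gamma t :
  qf 1%:M (gamma *: ctrl0 N u t) = gamma ^+ 2 * \sum_k ctrl0 N u t k 0 ^+ 2.
Proof. by rewrite qf1E mulr_sumr; apply: eq_bigr => k _; rewrite mxE exprMn. Qed.

Lemma in_L2_scale_ctrl0 (N : 'I_m -> 'M[R]_n) (u : R -> 'cV[R]_m) gamma :
  in_L2 u -> in_L2 (fun t => gamma *: ctrl0 N u t).
Proof.
move=> uL; have [Iu hu] := in_L2_loc_int uL; have [mu_ _] := uL.
have mg i : measurable_fun (`[0, +oo[%classic : set R) (fun s => (gamma *: ctrl0 N u s) i 0).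
  case: (eqVneq (N i) 0) => Ni.
    rewrite (_ : (fun s => _) = cst 0); first exact: measurable_cst.
    by apply/funext => s; rewrite !mxE Ni eqxx mulr0.
  rewrite (_ : (fun s => _) = (fun s => gamma * u s i 0)); last first.
    by apply/funext => s; rewrite !mxE (negbTE Ni).
  by apply: measurable_funM => //; exact: measurable_cst.
have le t : qf 1%:M (gamma *: ctrl0 N u t) <= gamma ^+ 2 * qf 1%:M (u t).
  rewrite qf_scale_ctrl0 ler_wpM2l ?sqr_ge0// qf1E; apply: ler_sum => k _.
  by rewrite mxE; case: ifP => // _; rewrite expr0n /= sqr_ge0.
have Ig : loc_int (fun t => qf 1%:M (gamma *: ctrl0 N u t)).
  move=> T T0; apply: le_integrable (loc_intZ (gamma ^+ 2) Iu T0) => //.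
    apply/measurable_EFinP; rewrite (_ : (fun s => _) =
      (fun s => \sum_i (gamma *: ctrl0 N u s) i 0 ^+ 2)); last first.
      by apply/funext => s; rewrite qf1E.
    apply: measurable_sum => i; apply: measurable_funX.
    apply: measurable_funS (mg i) => //.
    by move=> z /=; rewrite !in_itv/= => /andP[->].
  move=> t _ /=; rewrite lee_fin !ger0_norm ?qf1_ge0 ?le//.
  by rewrite mulr_ge0 ?sqr_ge0 ?qf1_ge0.
split => //; apply: (@le_lt_trans _ _ (`|gamma| * fine (L2norm u))%:E); last exact: ltry.
apply: (L2norm_le _ Ig); first by rewrite mulr_ge0 ?fine_ge0// Lnorm_ge0.
move=> T T0; rewrite exprMn real_normK ?num_real//.
apply: le_trans (ler_wpM2l (sqr_ge0 gamma) (hu T T0)).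
rewrite -RintegralZl//; last exact: Iu.
by apply: le_Rintegral => //; [exact: Ig|exact: loc_intZ Iu _ T0].
Qed.

End BilinearSystem.

(** * Diagonal Gramians and truncation *)

Section DiagonalGramian.
Variable R : realType.

Lemma qf_diag n (t : 'rV[R]_n) x : qf (diag_mx t) x = \sum_i t 0 i * x i 0 ^+ 2.
Proof.
rewrite /qf -mulmxA mul_diag_mx mxE; apply: eq_bigr => i _.
by rewrite !mxE; ring.
Qed.

Lemma psd_diag n (t : 'rV[R]_n) : (forall i, 0 <= t 0 i) -> psd (diag_mx t).
Proof.
move=> t0 x; rewrite qf_diag; apply: sumr_ge0 => i _.
by rewrite mulr_ge0 ?sqr_ge0.
Qed.

Lemma posdef_diag_lower n (t : 'rV[R]_n) : posdefmx (diag_mx t) ->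
  exists2 c, 0 < c & forall x, c * qf 1%:M x <= qf (diag_mx t) x.
Proof.
move=> [_ pd].
have t0 i : 0 < t 0 i.
  have := pd (delta_mx i 0); rewrite -/(qf _ _) qf_diag (bigD1 i) //= big1.
    rewrite addr0 mxE !eqxx expr1n mulr1; apply.
    by apply/eqP => /matrixP/(_ i 0)/eqP; rewrite !mxE !eqxx oner_eq0.
  by move=> j /negbTE ji; rewrite mxE ji expr0n mulr0.
(* The inverse of [s] lies below every diagonal entry; the [+ 1] keeps [s] positive when [n = 0]. *)
pose s := \sum_i (t 0 i)^-1 + 1.
have s0 : 0 < s.
  by apply: ltr_wpDl => //; apply: sumr_ge0 => i _; rewrite invr_ge0 ltW.
exists s^-1; first by rewrite invr_gt0.
move=> x; rewrite qf1E qf_diag mulr_sumr; apply: ler_sum => i _.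
rewrite ler_wpM2r ?sqr_ge0// -[t 0 i]invrK lef_pV2 ?posrE ?invr_gt0//.
rewrite /s (bigD1 i) //= -addrA lerDl addr_ge0//.
by apply: sumr_ge0 => j _; rewrite invr_ge0 ltW.
Qed.

(** Truncation discards a term that is nonnegative when [T2] is, so [T1] becomes a supersolution of
    the truncated reachability equation. This bounds the reduced Gramian for BT. *)
Lemma gen_lyapunov_ulsub r d m gamma (A : 'M[R]_(r + d)) (N : 'I_m -> 'M[R]_(r + d))
    (T1 : 'M[R]_r) (T2 : 'M[R]_d) :
  gen_lyapunov gamma (ulsubmx A) (fun k => ulsubmx (N k)) T1 =
  ulsubmx (gen_lyapunov gamma A N (block_mx T1 0 0 T2))
  - gamma ^- 2 *: \sum_k ursubmx (N k) *m T2 *m (ursubmx (N k))^T.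
Proof.
have ul3 (M1 M2 : 'M[R]_(r + d)) F : ulsubmx (M1 + M2 + gamma ^- 2 *: \sum_(k < m) F k) =
    ulsubmx M1 + ulsubmx M2 + gamma ^- 2 *: \sum_(k < m) ulsubmx (F k).
  apply/matrixP => i j; rewrite !mxE !summxE; congr (_ + _ * _).
  by apply: eq_bigr => k _; rewrite !mxE.
rewrite [in RHS]gen_lyapunovE ul3 gen_lyapunovE -[RHS]addrA -scalerBr -sumrB.
congr (_ + _ + _ *: _).
- by rewrite -{2}[A]submxK mulmx_block block_mxKul mulmx0 addr0.
- by rewrite -{2}[A]submxK tr_block_mx mulmx_block block_mxKul mul0mx addr0.
apply: eq_bigr => k _.
rewrite -{3 4}[N k]submxK tr_block_mx !mulmx_block block_mxKul !mulmx0 addr0 add0r.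
by rewrite addrK.
Qed.

End DiagonalGramian.

(** * The error bound *)

Theorem theorem4p3 (R : realType) (r d m p q : nat)
    (A : 'M[R]_(r + d)) (N : 'I_m -> 'M[R]_(r + d))
    (C : 'M[R]_(p, r + d)) (X0 : 'M[R]_(r + d, q)) (v0 : 'cV[R]_q)
    (u : R -> 'cV[R]_m) (gamma : R)
    (P0 Q S : 'M[R]_(r + d)) (theta : 'rV[R]_(r + d)) (meth : reduction)
    (x : R -> 'cV[R]_(r + d)) (xt : R -> 'cV[R]_r) (Zt : R -> 'M[R]_r)
    (Y : 'M[R]_(r + d, r)) :
  let bA := S *m A *m invmx S in
  let bN := fun k : 'I_m => S *m N k *m invmx S in
  let bX0 := S *m X0 in
  let bC := C *m invmx S in
  let At := red_A meth bA in
  let Nt := fun k : 'I_m => red_N meth bA (bN k) in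
  let Xt0 := red_X0 bX0 in
  let Ct := red_C meth bA bC in
  let Theta1 : 'M[R]_r := diag_mx (lsubmx theta) in
  let Theta2 : 'M[R]_d := diag_mx (rsubmx theta) in
  let Pt := mx_improper_integral Zt in
  let err := fun t : R => C *m x t - Ct *m xt t in
  let gu0 := fun t : R => gamma *: ctrl0 N u t in
  let bound : R :=
    Num.sqrt (\tr (Theta2 *m W_x0 meth gamma bA bN bX0 Y Pt))
    * expR (2^-1 * fine (L2norm gu0) ^+ 2) * norm2 v0 in
  stable_spectrum A ->
  in_L2 u ->
  0 < gamma ->
  stable_spectrum (kron_lyapunov gamma A N) ->
  gen_lyapunov gamma A N P0 = - (X0 *m X0^T) ->
  gen_lyapunov gamma A^T (fun k => (N k)^T) Q = - (C^T *m C) ->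
  balancing P0 Q S theta ->
  posdefmx Theta1 ->
  (meth = SPA -> drsubmx bA \in unitmx) ->
  bilinear_solution A N u (X0 *m v0) x ->
  bilinear_solution At Nt u (Xt0 *m v0) xt ->
  matrix_ode_solution (gen_lyapunov gamma At Nt) (Xt0 *m Xt0^T) Zt ->
  (meth = SPA -> mx_improper_converges Zt) ->
  gen_sylvester gamma bA bN At Nt Y = - (bX0 *m (usubmx bX0)^T) ->
  (L2norm err <= bound%:E)%E.
Proof.
move=> bA bN bX0 bC At Nt Xt0 Ct Theta1 Theta2 Pt err gu0 bound.
move=> _ uL gamma0 stK LP0 LQ [uS SP SQ [theta0 _] _] pd1 uA22 solx solxt odeZ cvgS LY.
set Th := block_mx Theta1 0 0 Theta2.
have ThE : diag_mx theta = Th by rewrite -[theta in LHS]hsubmxK diag_mx_row.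
have Thp : psd Th by rewrite -ThE; exact: psd_diag.
have Th1s : Theta1^T = Theta1 by rewrite tr_diag_mx.
have Th1p : psd Theta1 by apply: psd_diag => i; rewrite mxE.
have Th2p : psd Theta2 by apply: psd_diag => i; rewrite mxE.
have LTh : gen_lyapunov gamma bA bN Th = - (bX0 *m bX0^T).
  rewrite -ThE -SP gen_lyapunov_similar// LP0 mulmxN mulNmx trmx_mul.
  by rewrite !mulmxA.
have LTh' : gen_lyapunov gamma bA^T (fun k => (bN k)^T) Th = - (bC^T *m bC).
  rewrite -ThE -SQ tr_similar// (_ : (fun k => _) =
    fun k => (invmx S)^T *m (N k)^T *m invmx (invmx S)^T); last first.
    by apply/funext => k; rewrite tr_similar.
  have := @gen_lyapunov_similar R _ m gamma (invmx S)^T A^T (fun k => (N k)^T) Q.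
  rewrite trmxK => ->; last by rewrite unitmx_tr unitmx_inv.
  by rewrite LQ mulmxN mulNmx trmx_mul !mulmxA.
have [c1 c10 cTh1] := posdef_diag_lower pd1.
have LTh1 y : qf (gen_lyapunov gamma At^T (fun k => (Nt k)^T) Theta1) y <= 0.
  rewrite (red_gen_lyapunov_adj gamma bN uA22 Theta1 Theta2) LTh'.
  set T := red_lift bA meth; rewrite qfB qfZ qf_sum subr_le0; apply: (@le_trans _ _ 0).
    rewrite -{2}[T]trmxK qf_congr qfN oppr_le0.
    by rewrite -{2}[bC]trmxK; exact: psd_gram.
  rewrite mulr_ge0 ?invr_ge0 ?sqr_ge0//; apply: sumr_ge0 => k _.
  set B := bold_N21 _ _ _; rewrite -{2}[B]trmxK qf_congr; exact: Th2p.
have Z0p : psd (Xt0 *m Xt0^T) := psd_gram Xt0.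
(* For SPA this is the hypothesis on the reduced Gramian; for BT the integrals are bounded by the
   supersolution [Theta1]. *)
have cvgZ : mx_improper_converges Zt.
  case E : meth; last exact: cvgS.
  have LW y : qf (gen_lyapunov gamma At Nt Theta1) y <= - qf (Xt0 *m Xt0^T) y.
    have -> : gen_lyapunov gamma At Nt Theta1 =
        gen_lyapunov gamma (ulsubmx bA) (fun k => ulsubmx (bN k)) Theta1.
      by rewrite /At /Nt E.
    rewrite (gen_lyapunov_ulsub gamma bA bN Theta1 Theta2) LTh.
    have -> : ulsubmx (- (bX0 *m bX0^T)) = - (Xt0 *m Xt0^T).
      by rewrite -{1 2}[bX0]vsubmxK tr_col_mx mul_col_row opp_block_mx block_mxKul.
    rewrite qfB qfN gerDl oppr_le0 qfZ qf_sum mulr_ge0 ?invr_ge0 ?sqr_ge0//.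
    by apply: sumr_ge0 => k _; rewrite qf_congr; exact: Th2p.
  have sZ0 : (Xt0 *m Xt0^T)^T = Xt0 *m Xt0^T by rewrite trmx_mul trmxK.
  apply: (ode_integral_converges odeZ Z0p sZ0 (W := Theta1)) => T y T0.
  exact: (ode_integral_le odeZ Th1s c10 cTh1 LTh1 Z0p Th1p LW).
have Ptp : psd Pt := psd_mx_improper_integral odeZ cvgZ Z0p.
have LPt : gen_lyapunov gamma At Nt Pt = - (Xt0 *m Xt0^T) :=
  gen_lyapunov_mx_improper_integral odeZ cvgZ.
have [V [c cert]] := stable_kron_cert_similar uS stK.
have Pep : psd (block_mx Th Y Y^T Pt).
  exact: (extended_gramian_psd cert Th1s c10 cTh1 LTh1 LTh LPt Ptp LY).
pose Ae := block_mx bA 0 0 At; pose Ne k := block_mx (bN k) 0 0 (Nt k).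
pose Xe := col_mx bX0 Xt0; pose Ce := row_mx bC (- Ct).
pose z t := col_mx (S *m x t) (xt t).
have LPe : gen_lyapunov gamma Ae Ne (block_mx Th Y Y^T Pt) = - (Xe *m Xe^T).
  rewrite gen_lyapunov_block LTh LPt LY -gen_sylvester_tr LY.
  have -> : (- (bX0 *m (usubmx bX0)^T))^T = - (Xt0 *m bX0^T).
    by rewrite raddfN /= trmx_mul trmxK.
  by rewrite tr_col_mx mul_col_row opp_block_mx.
(* [V] stays a certificate under a stabilizing shift, and the same shift makes the semistable
   [Theta1] strict. *)
have certe e : 0 < e -> exists V' c', stability_cert gamma (Ae - e%:M) Ne V' c'.
  move=> e0.
  have -> : Ae - e%:M = block_mx (bA - e%:M) 0 0 (At - e%:M).
    by rewrite scalar_mx_block opp_block_mx add_block_mx !oppr0 !addr0.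
  have k0 : 0 < 2 * e * c1 by rewrite !mulr_gt0.
  apply: (stability_cert_block (V := V) (c := c) _ Th1s c10 cTh1 k0
    (semistable_cert_shift Th1s c10 cTh1 LTh1 e0)).
  have Vp := cert_psd cert; case: cert => sV c0 cV LV; split => // y.
  rewrite raddfB /= tr_scalar_mx gen_lyapunov_shift qfB qfZ.
  by have := LV y; have := mulr_ge0 (ltW e0) (Vp y); lra.
have Iu k := in_L2_entry_loc_int k uL.
have [x0 px] := bilinear_solution_primitive Iu solx.
have [xt0 pxt] := bilinear_solution_primitive Iu solxt.
have z0 : z 0 = Xe *m v0 by rewrite /z x0 xt0 mul_col_mx mulmxA.
have pz : mx_primitive z (fun t => Ae *m z t + \sum_k u t k 0 *: (Ne k *m z t)).
  have lS : linear (fun y : 'cV[R]_(r + d) => S *m y).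
    by move=> a y1 y2; rewrite mulmxDr -scalemxAr.
  have pSx := mx_primitive_linear lS px.
  have fE t : Ae *m z t + \sum_k u t k 0 *: (Ne k *m z t) =
      col_mx (S *m (A *m x t + \sum_k u t k 0 *: (N k *m x t)))
             (At *m xt t + \sum_k u t k 0 *: (Nt k *m xt t)).
    have sumcol (F1 : 'I_m -> 'cV[R]_(r + d)) (F2 : 'I_m -> 'cV[R]_r) :
        \sum_k col_mx (F1 k) (F2 k) = col_mx (\sum_k F1 k) (\sum_k F2 k).
      apply/matrixP => i j; rewrite summxE.
      by case: (split_ordP i) => {}i ->; rewrite (col_mxEu, col_mxEd) summxE;
        apply: eq_bigr => k _; rewrite (col_mxEu, col_mxEd).
    have simE (M : 'M[R]_(r + d)) : S *m M *m invmx S *m (S *m x t) = S *m (M *m x t).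
      by rewrite !mulmxA mulmxKV.
    rewrite /Ae mul_block_col !mul0mx addr0 add0r simE mulmxDr -add_col_mx mulmx_sumr.
    rewrite -sumcol; congr (_ + _); apply: eq_bigr => k _.
    by rewrite mul_block_col !mul0mx addr0 add0r simE scale_col_mx -scalemxAr.
  move=> i j; case: (split_ordP i) => i' ->.
    apply: eq_primitive (pSx i' j) => t _; first by rewrite /z col_mxEu.
    by rewrite fE col_mxEu.
  apply: eq_primitive (pxt i' j) => t _; first by rewrite /z col_mxEd.
  by rewrite fE col_mxEd.
have gL : in_L2 gu0 := in_L2_scale_ctrl0 N gamma uL.
have [Ig hg] := in_L2_loc_int gL.
set F2 := fine (L2norm gu0) ^+ 2 in hg.
have Iv : loc_int (fun t => \sum_k ctrl0 N u t k 0 ^+ 2).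
  have g20 : gamma ^+ 2 != 0 by rewrite sqrf_eq0 gt_eqF.
  have h := loc_int_primitive (loc_intZ (gamma ^- 2) Ig).
  apply: primitive_int (eq_primitive (fun _ _ => erefl) _ h) => t _ /=.
  by rewrite qf_scale_ctrl0 mulKf.
have vG T : 0 <= T ->
    gamma ^+ 2 * \int[@lebesgue_measure R]_(s in `[0, T]) (\sum_k ctrl0 N u s k 0 ^+ 2) <= F2.
  move=> T0; rewrite -RintegralZl//; last exact: Iv.
  apply: le_trans (hg T T0); rewrite le_eqVlt; apply/orP; left; apply/eqP.
  by apply: eq_Rintegral => s _; rewrite qf_scale_ctrl0.
(* When [N k = 0] the reduced matrix vanishes too, so the control [u k] acts on neither half of the
   coupled system; hence [u^0] in the bound. *)
have uv k : (forall t, ctrl0 N u t k 0 = u t k 0) \/ Ne k = 0.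
  case: (eqVneq (N k) 0) => Nk; [right|left]; last by move=> t; rewrite mxE (negbTE Nk).
  rewrite /Ne /Nt /bN Nk mulmx0 mul0mx.
  have -> : red_N meth bA 0 = 0.
    have ul0 : ulsubmx (0 : 'M[R]_(r + d)) = 0 by apply/matrixP => i j; rewrite !mxE.
    have ur0 : ursubmx (0 : 'M[R]_(r + d)) = 0 by apply/matrixP => i j; rewrite !mxE.
    by rewrite /red_N; case: (meth); rewrite ul0 ?ur0 ?mul0mx ?subr0.
  exact: block_mx0.
have outE t : Ce *m z t = err t.
  by rewrite mul_row_col mulNmx mulmxA mulmxKV.
have kE : \tr (Ce *m block_mx Th Y Y^T Pt *m Ce^T) = \tr (Theta2 *m W_x0 meth gamma bA bN bX0 Y Pt).
  rewrite -(red_trace_identity uA22 LTh LTh' LY LPt).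
  rewrite mul_row_block tr_row_mx mul_row_col raddfN /= !mulmxN !mulmxDl !mulNmx.
  rewrite !mxtraceD !raddfN /= mxtraceD raddfN /=.
  have -> : \tr (Ct *m Y^T *m bC^T) = \tr (bC *m Y *m Ct^T).
    by rewrite -mxtrace_tr !trmx_mul !trmxK mulmxA.
  by rewrite -/Ct; ring.
(* [Num.sqrt] is 0 on negative numbers, so squaring the bound requires this sign. It is not visible
   on [W_x0] and comes from the positivity of the coupled Gramian. *)
have k0 : 0 <= \tr (Theta2 *m W_x0 meth gamma bA bN bX0 Y Pt).
  by rewrite -kE mxtrace_congr_qf; apply: sumr_ge0 => i _; exact: Pep.
have bound0 : 0 <= bound.
  by rewrite /bound !mulr_ge0 ?sqrtr_ge0 ?expR_ge0.
have boundE : bound ^+ 2 = expR F2 * qf 1%:M v0 * \tr (Theta2 *m W_x0 meth gamma bA bN bX0 Y Pt).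
  rewrite /bound !exprMn sqr_sqrtr// norm2_sqr [expR _ ^+ 2]expr2 -expRD -mulrDl.
  have -> : 2^-1 + 2^-1 = 1 :> R by lra.
  by rewrite mul1r -/F2; ring.
have errE t : qf 1%:M (err t) = qf 1%:M (Ce *m z t) by rewrite outE.
apply: L2norm_le => //.
  move=> T T0; rewrite (_ : (fun s => _) = (fun s => qf 1%:M (Ce *m z s))); last exact/funext.
  exact: output_loc_int pz Ce T T0.
move=> T T0; rewrite boundE -kE.
have -> : \int[@lebesgue_measure R]_(s in `[0, T]) qf 1%:M (err s) =
    \int[@lebesgue_measure R]_(s in `[0, T]) qf 1%:M (Ce *m z s).
  by apply: eq_Rintegral => s _; exact: errE.
exact: (output_energy_bound gamma0 pz uv Iv vG Ce z0 Pep LPe certe T0).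
Qed.
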